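(* For arbitrary $\sigma\ge0$, $L>\mu>0$ and $\tau\in\mathbb{N}^*$ there exists an instance of the optimization problem $\min_{x}f(x)$, $f(x)=\mathbb{E}_{Z\sim\pi}[F(x,Z)]$, with Markovian stochastic gradient oracle satisfying: $f$ is $L$-smooth and $\mu$-strongly convex; the noise $\{Z_i\}$ is a stationary Markov chain with unique invariant distribution $\pi$ whose kernel $\mathrm{Q}$ satisfies $\sup_{z,z'}\frac12\|\mathrm{Q}^k(z,\cdot)-\mathrm{Q}^k(z',\cdot)\|_{\mathsf{TV}}\le(1/4)^{\lfloor k/\tau\rfloor}$ for all $k$; $\mathbb{E}_\pi[\nabla F(x,Z)]=\nabla f(x)$ and $\|\nabla F(x,z)-\nabla f(x)\|^2\le\sigma^2+\delta^2\|\nabla f(x)\|^2$ for all $x,z$ with $\delta=1$; such that for any first-order gradient method it takes at least $$N=\Omega\Big(\tau\sqrt{\tfrac L\mu}\log\tfrac1\varepsilon+\frac{\tau\sigma^2}{\mu^2\varepsilon}\Big)$$ oracle calls in order to achieve $\mathbb{E}[\|x^N-x^*\|^2]\le\varepsilon$, where $x^*$ is the minimizer of $f$.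
   Context: A first-order gradient method here accesses $f$ only through the stochastic oracle: at its $i$-th oracle call it submits a query point $x_i$ (determined by the previously observed oracle outputs) and receives $\nabla F(x_i,Z_i)$, where $Z_1,Z_2,\dots$ are successive states of the Markov chain; $x^N$ is its output after $N$ oracle calls. $\|\cdot\|_{\mathsf{TV}}$ is total variation norm.
   Formalization: The instance is chosen after the method, ε and N (minimax order), since for one fixed instance the method that always outputs x* needs no oracle calls; Ω means an absolute constant, for all ε below an absolute threshold, with ‖x*‖≤1. *)

(* Defs.v *)
From HB Require Import structures.
From mathcomp Require Import all_boot all_order all_algebra.
From mathcomp Require Import all_classical all_reals all_analysis.
Set Implicit Arguments. Unset Strict Implicit. Unset Printing Implicit Defensive.
Import Order.TTheory GRing.Theory Num.Theory.
Local Open Scope ring_scope.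

Section Vec.
Variables (R : realType) (d : nat).

Definition vdot (u v : 'rV[R]_d) : R := \sum_(i < d) u ord0 i * v ord0 i.
Definition vnorm2 (u : 'rV[R]_d) : R := vdot u u.
Definition vnorm (u : 'rV[R]_d) : R := Num.sqrt (vnorm2 u).

Definition is_gradient (f : 'rV[R]_d -> R) (g : 'rV[R]_d -> 'rV[R]_d) : Prop :=
  forall x e, 0 < e -> exists2 dl, 0 < dl &
    forall h, vnorm h < dl -> `|f (x + h) - f x - vdot (g x) h| <= e * vnorm h.

Definition L_smooth (L : R) (g : 'rV[R]_d -> 'rV[R]_d) : Prop :=
  forall x y, vnorm (g x - g y) <= L * vnorm (x - y).

Definition strongly_convex (mu : R) (f : 'rV[R]_d -> R) (g : 'rV[R]_d -> 'rV[R]_d) : Prop :=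
  forall x y, f x + vdot (g x) (y - x) + mu / 2 * vnorm2 (y - x) <= f y.

Definition is_minimizer (f : 'rV[R]_d -> R) (xs : 'rV[R]_d) : Prop :=
  forall x, f xs <= f x.
End Vec.

Section Markov.
Variables (R : realType) (S : finType).

Definition is_distr (p : S -> R) : Prop := (forall z, 0 <= p z) /\ \sum_z p z = 1.
Definition is_kernel (Q : S -> S -> R) : Prop := forall z, is_distr (Q z).
Definition is_invariant (Q : S -> S -> R) (p : S -> R) : Prop :=
  forall w, \sum_z p z * Q z w = p w.
Definition unique_invariant (Q : S -> S -> R) (pi : S -> R) : Prop :=
  is_distr pi /\ is_invariant Q pi /\
  forall p, is_distr p -> is_invariant Q p -> forall z, p z = pi z.

Fixpoint kpow (Q : S -> S -> R) (k : nat) : S -> S -> R :=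
  match k with
  | 0 => fun z w => (z == w)%:R
  | k'.+1 => fun z w => \sum_u kpow Q k' z u * Q u w
  end.

Definition tv_norm (p q : S -> R) : R := \sum_z `|p z - q z|.

Definition mixing (Q : S -> S -> R) (tau : nat) : Prop :=
  forall k z z', tv_norm (kpow Q k z) (kpow Q k z') / 2 <= (1 / 4) ^+ (k %/ tau).

Fixpoint chain_weight (Q : S -> S -> R) (z : S) (s : seq S) : R :=
  match s with
  | [::] => 1
  | z' :: s' => Q z z' * chain_weight Q z' s'
  end.
Definition traj_prob (pi : S -> R) (Q : S -> S -> R) (s : seq S) : R :=
  match s with
  | [::] => 1
  | z :: s' => pi z * chain_weight Q z s'
  end.
Definition expect_traj (N : nat) (pi : S -> R) (Q : S -> S -> R) (g : seq S -> R) : R :=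
  \sum_(t : N.-tuple S) traj_prob pi Q t * g t.
End Markov.

Section Run.
Variables (R : realType) (d : nat) (S : finType).
(* query acc = next query point given the list acc of oracle outputs observed
   so far; the oracle answers grad F (x_i, Z_i). Returns all N outputs. *)
Fixpoint run_oracle (query : seq 'rV[R]_d -> 'rV[R]_d)
    (gF : 'rV[R]_d -> S -> 'rV[R]_d) (zs : seq S) (acc : seq 'rV[R]_d) : seq 'rV[R]_d :=
  match zs with
  | [::] => acc
  | z :: zs' => run_oracle query gF zs' (rcons acc (gF (query acc) z))
  end.
End Run.

Definition valid_instance (R : realType) (d : nat) (S : finType)
  (sigma L mu : R) (tau : nat) (pi : S -> R) (Q : S -> S -> R)
  (F : 'rV[R]_d -> S -> R) (gF : 'rV[R]_d -> S -> 'rV[R]_d)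
  (f : 'rV[R]_d -> R) (gf : 'rV[R]_d -> 'rV[R]_d) (xstar : 'rV[R]_d) : Prop :=
  is_kernel Q /\ unique_invariant Q pi /\ mixing Q tau /\
  (forall z, is_gradient (fun x => F x z) (fun x => gF x z)) /\
  (forall x, f x = \sum_z pi z * F x z) /\
  is_gradient f gf /\ L_smooth L gf /\ strongly_convex mu f gf /\
  (forall x, \sum_z pi z *: gF x z = gf x) /\
  (forall x z, vnorm2 (gF x z - gf x) <= sigma ^+ 2 + 1 ^+ 2 * vnorm2 (gf x)) /\
  is_minimizer f xstar.

(* Main.v *)
(* The two terms of the bound are forced by different instances; for given
   parameters the larger term decides which one is used. In all of them the state
   is redrawn from [pi] with probability [3 / (tau + 3)] per step, so that it
   stays put for about [tau] steps.

   Condition number below 16: in one of two states the oracle answers 0, so before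
   the first visit to the other state the minimizers e and -e look the same.

   Noise term: the oracle answers [mu x -/+ sigma / 2], the sign being the state.
   A bias of order [mu sqrt eps / sigma] in [pi] moves the minimizer by
   [sqrt eps], and detecting it takes [tau sigma^2 / (mu^2 eps)] steps.

   Condition number at least 16: [f] is Nesterov's chain quadratic in rotated
   coordinates, written [c/2 |B (y - geo)|^2] with [B] bidiagonal. The function
   [F] equals [f + h] in one state and [f - h] in the other, where [h] is built so
   that its gradient cancels the component of [grad f] along the next undiscovered
   coordinate, with a sign alternating with that coordinate. A state thus reveals a
   single coordinate before the other state is needed, and one coordinate costs
   [tau] steps. [h] is supported near the subspaces spanned by the first coordinates;
   these are at positive distance from the minimizer, and the linear decrease of
   the cutoff gains more than the cross terms lose, so [|grad h| <= |grad f|]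
   holds even without additive noise. *)
Require Import Defs.
From HB Require Import structures.
From mathcomp Require Import all_boot all_order all_algebra.
From mathcomp Require Import all_classical all_reals all_analysis.
From mathcomp Require Import ring lra.
Import Order.TTheory GRing.Theory Num.Theory.
Local Open Scope ring_scope.

(** * Euclidean vectors and gradients *)

Section Euclid.
Context {R : realType} {d : nat}.
Implicit Types (u v w : 'rV[R]_d) (a : R).

Lemma vdotC u v : vdot u v = vdot v u.
Proof. by apply: eq_bigr => i _; rewrite mulrC. Qed.

Lemma vdotDl u v w : vdot (u + v) w = vdot u w + vdot v w.
Proof. by rewrite /vdot -big_split; apply: eq_bigr => i _; rewrite !mxE mulrDl. Qed.

Lemma vdotZl a u v : vdot (a *: u) v = a * vdot u v.
Proof. by rewrite /vdot mulr_sumr; apply: eq_bigr => i _; rewrite !mxE mulrA. Qed.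

Lemma vdotNl u v : vdot (- u) v = - vdot u v.
Proof. by rewrite -scaleN1r vdotZl mulN1r. Qed.

Lemma vdotDr u v w : vdot u (v + w) = vdot u v + vdot u w.
Proof. by rewrite vdotC vdotDl !(vdotC _ u). Qed.

Lemma vdotZr a u v : vdot u (a *: v) = a * vdot u v.
Proof. by rewrite vdotC vdotZl vdotC. Qed.

Lemma vdotNr u v : vdot u (- v) = - vdot u v.
Proof. by rewrite vdotC vdotNl vdotC. Qed.

Lemma vdot0l v : vdot 0 v = 0.
Proof. by rewrite /vdot big1 // => i _; rewrite mxE mul0r. Qed.

Lemma vdot_suml I (r : seq I) (P : pred I) (F : I -> 'rV[R]_d) v :
  vdot (\sum_(i <- r | P i) F i) v = \sum_(i <- r | P i) vdot (F i) v.
Proof. by elim/big_rec2: _ => [|i x y _ <-]; rewrite ?vdot0l ?vdotDl. Qed.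

Lemma vdot_mulmx {n} (x : 'rV[R]_d) (y : 'rV[R]_n) (A : 'M[R]_(d, n)) :
  vdot (x *m A) y = vdot x (y *m A^T).
Proof.
have E m (p r : 'rV[R]_m) : vdot p r = (p *m r^T) 0 0.
  by rewrite mxE; apply: eq_bigr => i _; rewrite !mxE.
by rewrite !E trmx_mul trmxK mulmxA.
Qed.

Lemma vnorm2_ge0 u : 0 <= vnorm2 u.
Proof. by apply: sumr_ge0 => i _; rewrite -expr2 sqr_ge0. Qed.

Lemma vnorm2D u v : vnorm2 (u + v) = vnorm2 u + 2 * vdot u v + vnorm2 v.
Proof. by rewrite /vnorm2 !vdotDl !vdotDr (vdotC v u); ring. Qed.

Lemma vnorm2Z a u : vnorm2 (a *: u) = a ^+ 2 * vnorm2 u.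
Proof. by rewrite /vnorm2 vdotZl vdotZr mulrA. Qed.

Lemma vnorm2N u : vnorm2 (- u) = vnorm2 u.
Proof. by rewrite /vnorm2 vdotNl vdotNr opprK. Qed.

Lemma vnorm2_0 : vnorm2 (0 : 'rV[R]_d) = 0.
Proof. exact: vdot0l. Qed.

Lemma vnorm2_eq0 u : vnorm2 u = 0 -> u = 0.
Proof.
move/eqP; rewrite psumr_eq0 => [/allP u0|i _]; last by rewrite -expr2 sqr_ge0.
apply/rowP => i; rewrite mxE; apply/eqP.
by have := u0 i (mem_index_enum _); rewrite /= mulf_eq0 orbb.
Qed.

Lemma vnorm_ge0 u : 0 <= vnorm u.
Proof. exact: sqrtr_ge0. Qed.

Lemma vnorm_sqr u : vnorm u ^+ 2 = vnorm2 u.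
Proof. by rewrite sqr_sqrtr ?vnorm2_ge0. Qed.

Lemma vnorm0 : vnorm (0 : 'rV[R]_d) = 0.
Proof. by rewrite /vnorm vnorm2_0 sqrtr0. Qed.

Lemma vnorm_eq0 u : vnorm u = 0 -> u = 0.
Proof. by move=> u0; apply: vnorm2_eq0; rewrite -vnorm_sqr u0 expr0n. Qed.

Lemma vnormN u : vnorm (- u) = vnorm u.
Proof. by rewrite /vnorm vnorm2N. Qed.

Lemma vnormZ a u : vnorm (a *: u) = `|a| * vnorm u.
Proof. by rewrite /vnorm vnorm2Z sqrtrM ?sqr_ge0 // sqrtr_sqr. Qed.

Lemma vnorm_le a u : 0 <= a -> vnorm2 u <= a ^+ 2 -> vnorm u <= a.
Proof. by move=> a0; rewrite -vnorm_sqr ler_pXn2r // ?nnegrE ?vnorm_ge0. Qed.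

Lemma vdot_le u v : `|vdot u v| <= vnorm u * vnorm v.
Proof.
have [v0|vN0] := eqVneq (vnorm v) 0.
  by rewrite (vnorm_eq0 v v0) vdotC vdot0l normr0 vnorm0 mulr0.
have vP : 0 < vnorm v by rewrite lt_def vN0 vnorm_ge0.
rewrite -(@ler_pXn2r _ 2) ?nnegrE ?mulr_ge0 ?vnorm_ge0 // real_normK ?num_real //.
have := vnorm2_ge0 (vnorm2 v *: u - vdot u v *: v).
rewrite vnorm2D vnorm2N !vnorm2Z vdotNr vdotZl vdotZr exprMn !vnorm_sqr.
have v2P : 0 < vnorm2 v by rewrite -vnorm_sqr exprn_gt0.
rewrite (_ : _ + _ + _ = vnorm2 v * (vnorm2 u * vnorm2 v - vdot u v ^+ 2)).
  by rewrite pmulr_rge0 // subr_ge0.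
by rewrite /vnorm2; ring.
Qed.

Lemma ler_vnormD u v : vnorm (u + v) <= vnorm u + vnorm v.
Proof.
apply: vnorm_le; first by rewrite addr_ge0 ?vnorm_ge0.
have := le_trans (ler_norm _) (vdot_le u v).
by rewrite vnorm2D sqrrD !vnorm_sqr; lra.
Qed.

Lemma ler_vnorm_dist u v : `|vnorm u - vnorm v| <= vnorm (u - v).
Proof.
have A (x y : 'rV[R]_d) : vnorm x - vnorm y <= vnorm (x - y).
  by have := ler_vnormD (x - y) y; rewrite subrK; lra.
have := A v u; have := A u v; rewrite -(vnormN (v - u)) opprB ler_norml => ? ?.
by apply/andP; split; lra.
Qed.

Lemma ler_vnorm_sum I (r : seq I) (P : pred I) (F : I -> 'rV[R]_d) :
  vnorm (\sum_(i <- r | P i) F i) <= \sum_(i <- r | P i) vnorm (F i).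
Proof.
elim/big_rec2: _ => [|i x y _ le]; first by rewrite vnorm0.
exact: le_trans (ler_vnormD _ _) (lerD _ le).
Qed.

Lemma ler_coord_vnorm u i : `|u ord0 i| <= vnorm u.
Proof.
rewrite -(@ler_pXn2r _ 2) ?nnegrE ?vnorm_ge0 // real_normK ?num_real // vnorm_sqr.
rewrite /vnorm2 /vdot (bigD1 i) //= -expr2 lerDl sumr_ge0 // => j _.
by rewrite -expr2 sqr_ge0.
Qed.

Lemma vdot_delta u i : vdot (delta_mx ord0 i) u = u ord0 i.
Proof.
rewrite /vdot (bigD1 i) //= big1 => [|j /negPf ji]; rewrite !mxE !eqxx ?ji.
  by rewrite mul1r addr0.
by rewrite mul0r.
Qed.

Lemma vnorm_delta i : vnorm (delta_mx ord0 i : 'rV[R]_d) = 1.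
Proof. by rewrite /vnorm /vnorm2 vdot_delta mxE !eqxx sqrtr1. Qed.

(* A differentiability notion with quadratic remainder: all the functions below
   satisfy it, and it is closed under products without any limit argument. *)
Definition qgrad (f : 'rV[R]_d -> R) (x g : 'rV[R]_d) :=
  exists2 C : R, 0 <= C &
    forall h, vnorm h <= 1 -> `|f (x + h) - f x - vdot g h| <= C * vnorm h ^+ 2.

Lemma qgrad_is_gradient f g : (forall x, qgrad f x (g x)) -> is_gradient f g.
Proof.
move=> fg x e e0; have [C C0 fC] := fg x.
have C1 : 0 < C + 1 by lra.
exists (Num.min 1 (e / (C + 1))) => [|h]; first by rewrite lt_min ltr01 divr_gt0.
rewrite lt_min ltr_pdivlMr // => /andP[h1 he].
apply: le_trans (fC h (ltW h1)) _.
have h0 := vnorm_ge0 h.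
by rewrite expr2 mulrA ler_wpM2r //; nra.
Qed.

Lemma qgrad_cst a x : qgrad (fun=> a) x 0.
Proof. by exists 0 => // h _; rewrite vdot0l !subrr normr0 mul0r. Qed.

Lemma qgrad_coord i x : qgrad (fun y => y ord0 i) x (delta_mx ord0 i).
Proof.
exists 0 => // h _; rewrite vdot_delta mxE mul0r.
by rewrite (_ : _ - _ - _ = 0) ?normr0 //; ring.
Qed.

Lemma qgradD f1 f2 x g1 g2 : qgrad f1 x g1 -> qgrad f2 x g2 ->
  qgrad (fun y => f1 y + f2 y) x (g1 + g2).
Proof.
move=> [C1 C10 H1] [C2 C20 H2]; exists (C1 + C2) => [|h hh]; first exact: addr_ge0.
rewrite vdotDl mulrDl (_ : _ - _ - _ = (f1 (x + h) - f1 x - vdot g1 h) +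
  (f2 (x + h) - f2 x - vdot g2 h)); last by ring.
exact: le_trans (ler_normD _ _) (lerD (H1 h hh) (H2 h hh)).
Qed.

Lemma qgradZ a f x g : qgrad f x g -> qgrad (fun y => a * f y) x (a *: g).
Proof.
move=> [C C0 H]; exists (`|a| * C) => [|h hh]; first by rewrite mulr_ge0.
rewrite vdotZl -!mulrBr normrM -mulrA ler_wpM2l //; exact: H.
Qed.

Lemma qgrad_sum {I} (r : seq I) (F : I -> 'rV[R]_d -> R) x (G : I -> 'rV[R]_d) :
  (forall i, qgrad (F i) x (G i)) ->
  qgrad (fun y => \sum_(i <- r) F i y) x (\sum_(i <- r) G i).
Proof.
move=> FG; elim: r => [|i r IH].
  rewrite big_nil; have [C C0 H] := qgrad_cst 0 x; exists C => // h /H.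
  by rewrite !big_nil.
rewrite big_cons; have [C C0 H] := qgradD _ _ _ _ _ (FG i) IH; exists C => // h /H.
by rewrite !big_cons.
Qed.

Lemma qgradM f1 f2 x g1 g2 : qgrad f1 x g1 -> qgrad f2 x g2 ->
  qgrad (fun y => f1 y * f2 y) x (f2 x *: g1 + f1 x *: g2).
Proof.
move=> [C1 C10 H1] [C2 C20 H2].
set a1 := `|f1 x|; set a2 := `|f2 x|; set n1 := vnorm g1; set n2 := vnorm g2.
have ? : 0 <= a1 by exact: normr_ge0.
have ? : 0 <= a2 by exact: normr_ge0.
have ? : 0 <= n1 by exact: vnorm_ge0.
have ? : 0 <= n2 by exact: vnorm_ge0.
exists (a2 * C1 + a1 * C2 + (n1 + C1) * (n2 + C2)) => [|h hh].
  by rewrite !addr_ge0 ?mulr_ge0 ?addr_ge0.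
have {H1} := H1 h hh; have {H2} := H2 h hh; have h0 := vnorm_ge0 h.
rewrite vdotDl !vdotZl.
set r2 := f2 (x + h) - _ - _; set r1 := f1 (x + h) - _ - _ => H2 H1.
have E1 : f1 (x + h) - f1 x = vdot g1 h + r1 by rewrite /r1; ring.
have E2 : f2 (x + h) - f2 x = vdot g2 h + r2 by rewrite /r2; ring.
have B (g : 'rV[R]_d) (r C : R) : 0 <= C -> `|r| <= C * vnorm h ^+ 2 ->
    `|vdot g h + r| <= (vnorm g + C) * vnorm h.
  move=> C0 rC; apply: le_trans (ler_normD _ _) _; rewrite mulrDl lerD ?vdot_le //.
  apply: le_trans rC _; rewrite ler_wpM2l // expr2 -[leRHS]mulr1 ler_wpM2l //.
have B1 := B g1 _ _ C10 H1; have B2 := B g2 _ _ C20 H2.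
(* The remainder of the product is two scaled remainders plus the product of the increments; each
   increment is at most linear in [h], since [vnorm h <= 1] absorbs its quadratic part. *)
rewrite (_ : _ - _ = f2 x * r1 + f1 x * r2 + (vdot g1 h + r1) * (vdot g2 h + r2)).
  rewrite [leRHS]mulrDl [X in _ <= X + _]mulrDl.
  apply: le_trans (ler_normD _ _) (lerD _ _).
    by apply: le_trans (ler_normD _ _) (lerD _ _);
      rewrite normrM -mulrA ler_wpM2l.
  rewrite normrM; have := ler_pM (normr_ge0 _) (normr_ge0 _) B1 B2.
  by move/le_trans; apply; rewrite le_eqVlt; apply/orP; left; apply/eqP; rewrite /n1 /n2; ring.
by rewrite -E1 -E2 /r1 /r2; ring.
Qed.

End Euclid.

(** * Smooth cutoffs *)

Section Gate.
Context {R : realType} {n : nat}.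
Implicit Types (y h : 'rV[R]_n) (k i : 'I_n) (r : R).

Definition tail (k : nat) y : 'rV[R]_n := \row_j (if (k <= j)%N then y ord0 j else 0).

Lemma tailD k y h : tail k (y + h) = tail k y + tail k h.
Proof. by apply/rowP => j; rewrite !mxE; case: ifP; rewrite ?addr0. Qed.

Lemma vdot_tail (k : nat) y h : vdot (tail k y) h = vdot (tail k y) (tail k h).
Proof. by apply: eq_bigr => j _; rewrite !mxE; case: ifP; rewrite ?mul0r. Qed.

Lemma vnorm_tail_le (k l : nat) y : (l <= k)%N -> vnorm (tail k y) <= vnorm (tail l y).
Proof.
move=> lk; rewrite ler_wsqrtr //; apply: ler_sum => j _; rewrite !mxE -!expr2.
case: ifP => kj; first by rewrite (leq_trans lk kj).
by rewrite expr0n /= sqr_ge0.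
Qed.

Lemma tail0 y : tail 0 y = y.
Proof. by apply/rowP => j; rewrite mxE. Qed.

Lemma ler_coord_tail (k : nat) i y : (k <= i)%N -> `|y ord0 i| <= vnorm (tail k y).
Proof. by move=> ki; have := ler_coord_vnorm (tail k y) i; rewrite mxE ki. Qed.

(** Equals 1 on the span of the first [k] coordinates and, for [r > 0], vanishes at distance [r] or
    more from it. *)
Definition cutoff r (k : nat) y : R := Num.max 0 (1 - vnorm (tail k y) / r).

(** The square smooths the kink of the hinge at distance [r]; the factor [y ord0 k] smooths the kink
    of the norm where the tail vanishes. *)
Definition gate r k y : R := y ord0 k * cutoff r k y ^+ 2.

(** Where the tail vanishes the quotient is 0 by convention and multiplies the zero vector, so the
    formula still gives the gradient. *)
Definition ggate r k y : 'rV[R]_n :=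
  cutoff r k y ^+ 2 *: delta_mx ord0 k
  - (2 / r * cutoff r k y * (y ord0 k / vnorm (tail k y))) *: tail k y.

Lemma cutoff_ge0 r k y : 0 <= cutoff r k y.
Proof. by rewrite le_max lexx. Qed.

Lemma cutoff_le1 r k y : 0 < r -> cutoff r k y <= 1.
Proof.
move=> r0; rewrite ge_max ler01 /= gerBl divr_ge0 ?vnorm_ge0 ?ltW //.
Qed.

Lemma cutoff_eq0 r k y : 0 < r -> r <= vnorm (tail k y) -> cutoff r k y = 0.
Proof. by move=> r0 ry; apply/max_idPl; rewrite subr_le0 ler_pdivlMr ?mul1r. Qed.

Lemma gate_ratio r k y : exists2 rho : R, `|rho| <= 1 &
  y ord0 k / vnorm (tail k y) = rho /\ y ord0 k = rho * vnorm (tail k y).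
Proof.
have := ler_coord_tail k k y (leqnn _).
set A := vnorm _; have A0 : 0 <= A by exact: vnorm_ge0.
have [->|AN0] := eqVneq A 0.
  by rewrite normr_le0 => /eqP ->; exists 0; rewrite ?normr0 ?ler01 // mul0r mulr0.
move=> yA; exists (y ord0 k / A); last by rewrite divfK.
by rewrite normrM normfV (ger0_norm A0) ler_pdivrMr ?mul1r // lt_def AN0.
Qed.

(** For the second bound: with [m] nonzero, the linear prediction fails only if the kink at 1 is
    crossed, and then [m] is itself at most [|b - a|]. *)
Lemma hinge_dist (a b : R) (m := Num.max 0 (1 - a)) (m' := Num.max 0 (1 - b)) :
  0 <= a -> 0 <= b ->
  `|m' - m| <= `|b - a| /\ `|m * (m' - m + (b - a))| <= (b - a) ^+ 2.
Proof.
move=> a0 b0; rewrite /m /m' {m m'}.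
have sq := real_normK (num_real (b - a)).
have [ha|ha] := leP 0 (1 - a); have [hb|hb] := leP 0 (1 - b).
- have -> : 1 - b - (1 - a) = - (b - a) by ring.
  split; first by rewrite normrN.
  by rewrite addNr mulr0 normr0 sqr_ge0.
- have ba : 0 <= b - a by lra.
  split; first by rewrite (ger0_norm ba) ler_norml; apply/andP; split; lra.
  rewrite ger0_norm; [nra|apply: mulr_ge0; lra].
- split; last by rewrite mul0r normr0 sqr_ge0.
  have ba : b - a <= 0 by lra.
  by rewrite (ler0_norm ba) ler_norml; apply/andP; split; lra.
- by rewrite subrr mul0r !normr0 normr_ge0 sqr_ge0.
Qed.

Lemma gate_qgrad r k y : 0 < r -> qgrad (gate r k) y (ggate r k y).
Proof.
move=> r0; set A := vnorm (tail k y).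
have A0 : 0 <= A by exact: vnorm_ge0.
exists (3 / r + 3 * A / r ^+ 2) => [|h _].
  by rewrite addr_ge0 ?divr_ge0 ?mulr_ge0 ?exprn_ge0 ?(ltW r0).
have [rho rho1 [rhoE yE]] := gate_ratio r k y.
set A' := vnorm (tail k (y + h)).
have A'0 : 0 <= A' by exact: vnorm_ge0.
set t := vnorm h; have t0 : 0 <= t by exact: vnorm_ge0.
set p := vnorm (tail k h).
have p0 : 0 <= p by exact: vnorm_ge0.
have pt : p <= t by rewrite /p /t -[in leRHS](tail0 h) vnorm_tail_le.
set D := vdot (tail k y) h.
(* Polarization expresses the inner product exactly through norms, so the point where the tail norm
   is not differentiable needs no separate case. *)
have DE : 2 * D = A' ^+ 2 - A ^+ 2 - p ^+ 2.
  by rewrite /A' /A /p /D tailD !vnorm_sqr vnorm2D vdot_tail; ring.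
have dA : `|A' - A| <= t.
  apply: le_trans pt; rewrite /A' /A tailD.
  by apply: le_trans (ler_vnorm_dist _ _) _; rewrite addrAC subrr add0r.
have hk : `|h ord0 k| <= t by exact: ler_coord_vnorm.
have [m1 m2] := hinge_dist (A / r) (A' / r) (divr_ge0 A0 (ltW r0)) (divr_ge0 A'0 (ltW r0)).
rewrite -mulrBl in m1 m2.
have C0 := cutoff_ge0 r k y; have C0' := cutoff_ge0 r k (y + h).
have C1 := cutoff_le1 r k y r0; have C1' := cutoff_le1 r k (y + h) r0.
rewrite /gate /ggate vdotDl vdotNl !vdotZl vdot_delta -/A -/D rhoE mxE yE -/A.
rewrite -/(cutoff r k y) -/(cutoff r k (y + h)) in m1 m2.
set m := cutoff r k y in m1 m2 C0 C1 *.
set m' := cutoff r k (y + h) in m1 m2 C0' C1' *.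
set x := h ord0 k in hk *.
set z := (A' - A) / r in m1 m2.
set e := m' - m + z in m2.
have zt : `|z| <= t / r.
  by rewrite normrM normfV (gtr0_norm r0) ler_wpM2r // invr_ge0 ltW.
have tr0 : 0 <= t / r by rewrite divr_ge0 // ltW.
have z2 : z ^+ 2 <= (t / r) ^+ 2.
  by rewrite -(real_normK (num_real z)) ler_pXn2r ?nnegrE.
have m'm : `|m' - m| <= t / r by exact: le_trans m1 zt.
(* Every summand carries two small factors; in the last one [m * e] is quadratic by [hinge_dist]. *)
have -> : (rho * A + x) * m' ^+ 2 - rho * A * m ^+ 2
    - (m ^+ 2 * x - 2 / r * m * rho * D)
  = x * (m' - m) * (m' + m) + rho * A * (m' - m) ^+ 2
    + (- (rho * m / r * (p ^+ 2 - (A' - A) ^+ 2)) + 2 * rho * A * (m * e)).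
  have -> : e = m' - m + (A' - A) / r by [].
  have -> : D = (A' ^+ 2 - A ^+ 2 - p ^+ 2) / 2 by rewrite -DE mulrC mulKf.
  by field; rewrite gt_eqF.
have E1 : `|x * (m' - m) * (m' + m)| <= 2 * (t ^+ 2 / r).
  rewrite !normrM (ger0_norm (addr_ge0 C0' C0)) (_ : 2 * _ = t * (t / r) * 2); last by ring.
  apply: ler_pM; rewrite ?mulr_ge0 ?addr_ge0 //; last by lra.
  exact: ler_pM.
have E2 : `|rho * A * (m' - m) ^+ 2| <= A * (t / r) ^+ 2.
  rewrite 2!normrM (ger0_norm A0) normrX; apply: ler_pM; rewrite ?mulr_ge0 ?exprn_ge0 //.
    by rewrite ler_piMl.
  by rewrite ler_pXn2r ?nnegrE.
have E3 : `|- (rho * m / r * (p ^+ 2 - (A' - A) ^+ 2))| <= t ^+ 2 / r.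
  rewrite normrN !normrM (ger0_norm C0) normfV (gtr0_norm r0) mulrAC.
  rewrite ler_wpM2r ?invr_ge0 ?(ltW r0) // -[leRHS]mul1r ler_pM ?mulr_ge0 //.
    by rewrite -[leRHS]mul1r ler_pM.
  have : (A' - A) ^+ 2 <= t ^+ 2.
    by rewrite -(real_normK (num_real (A' - A))) ler_pXn2r ?nnegrE.
  have : p ^+ 2 <= t ^+ 2 by rewrite ler_pXn2r ?nnegrE.
  have := sqr_ge0 (A' - A); have := sqr_ge0 p.
  by rewrite ler_norml => ? ? ? ?; apply/andP; split; lra.
have E4 : `|2 * rho * A * (m * e)| <= 2 * A * (t / r) ^+ 2.
  rewrite [X in X <= _]normrM; apply: ler_pM => //; last exact: le_trans m2 z2.
  by rewrite !normrM (ger0_norm A0) ger0_norm // -mulrA ler_pM2l // ler_piMl.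
apply: le_trans (ler_normD _ _) _; apply: le_trans (lerD (ler_normD _ _) (ler_normD _ _)) _.
apply: le_trans (lerD (lerD E1 E2) (lerD E3 E4)) _.
by rewrite expr_div_n le_eqVlt; apply/orP; left; apply/eqP; ring.
Qed.

(** With [s] the tail norm over [r], the squared norm is the average of [(1 - s)^4] and
    [((1 - s) (1 - 3 s))^2] with weights [1 - rho^2] and [rho^2]; both are at most [(1 - s / 2)^2].
    The linear decrease in [s] pays for the cross terms in [mask_le]. *)
Lemma vnorm_ggate r k y : 0 < r -> vnorm (tail k y) <= r ->
  vnorm (ggate r k y) <= 1 - vnorm (tail k y) / r / 2.
Proof.
move=> r0 yr; have [rho rho1 [rhoE yE]] := gate_ratio r k y.
set A := vnorm (tail k y) in yr rhoE yE *.
have A0 : 0 <= A by exact: vnorm_ge0.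
have s1 : A / r <= 1 by rewrite ler_pdivrMr ?mul1r.
have s0 : 0 <= A / r by rewrite divr_ge0 // ltW.
have mE : cutoff r k y = 1 - A / r by apply/max_idPr; rewrite subr_ge0.
apply: vnorm_le; first by lra.
rewrite /ggate mE rhoE vnorm2D vnorm2N !vnorm2Z vdotNr vdotZl vdotZr vdot_delta.
rewrite -!vnorm_sqr vnorm_delta -/A mxE leqnn yE.
have rho2 : rho ^+ 2 <= 1 by rewrite -(real_normK (num_real _)) expr_le1.
have rho20 : 0 <= rho ^+ 2 by exact: sqr_ge0.
set s := A / r in s0 s1 *.
have rN0 : r != 0 by rewrite gt_eqF.
have AE : A = s * r by rewrite /s divfK.
rewrite AE; clearbody s.
have -> : (1 - s) ^+ 2 ^+ 2 * 1 ^+ 2 +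
  2 * - ((1 - s) ^+ 2 * (2 / r * (1 - s) * rho * (rho * (s * r)))) +
  (2 / r * (1 - s) * rho) ^+ 2 * (s * r) ^+ 2 =
   (1 - rho ^+ 2) * ((1 - s) ^+ 2) ^+ 2 + rho ^+ 2 * ((1 - s) * (1 - 3 * s)) ^+ 2.
  by field.
have s2 : 0 <= s * (1 - s) by rewrite mulr_ge0 ?subr_ge0.
have B1 : ((1 - s) ^+ 2) ^+ 2 <= (1 - s / 2) ^+ 2.
  by rewrite ler_pXn2r ?nnegrE ?sqr_ge0 //; [rewrite expr2; nra|lra].
have B2 : ((1 - s) * (1 - 3 * s)) ^+ 2 <= (1 - s / 2) ^+ 2.
  rewrite -(real_normK (num_real ((1 - s) * (1 - 3 * s)))) ler_pXn2r ?nnegrE ?normr_ge0 //.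
    by rewrite ler_norml; apply/andP; split; nra.
  by lra.
have := ler_wpM2l rho20 B2; have rho3 : 0 <= 1 - rho ^+ 2 by lra.
by have := ler_wpM2l rho3 B1; lra.
Qed.

Lemma ggate_eq0 r k y : 0 < r -> r <= vnorm (tail k y) -> ggate r k y = 0.
Proof.
by move=> r0 /(cutoff_eq0 _ _ _ r0) c0; rewrite /ggate c0 expr0n mulr0 mul0r !scale0r subrr.
Qed.

Lemma gate_eq0 r k y : 0 < r -> r <= vnorm (tail k y) -> gate r k y = 0.
Proof. by move=> r0 /(cutoff_eq0 _ _ _ r0) c0; rewrite /gate c0 expr0n mulr0. Qed.

Lemma gate_le r k y : 0 < r -> `|gate r k y| <= `|y ord0 k|.
Proof.
move=> r0; rewrite [leLHS]normrM ler_piMr // normrX expr_le1 //.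
by rewrite ger0_norm ?cutoff_ge0 ?cutoff_le1.
Qed.

Lemma vnorm_ggate_le1 r k y : 0 < r -> vnorm (ggate r k y) <= 1.
Proof.
move=> r0; have [yr|ry] := leP (vnorm (tail k y)) r.
  apply: le_trans (vnorm_ggate _ _ _ r0 yr) _.
  by rewrite gerBl !divr_ge0 ?vnorm_ge0 // ltW.
by rewrite ggate_eq0 ?vnorm0 ?ltW.
Qed.

End Gate.

(** * Resampling chains *)

Section Resampling.
Context {R : realType} {S : finType}.
Implicit Types (th : R) (p : S -> R).

Definition resample th p (z w : S) : R := (1 - th) * (z == w)%:R + th * p w.

Lemma sum_eq1 (z : S) (F : S -> R) : \sum_w (z == w)%:R * F w = F z.
Proof.
rewrite (bigD1 z) //= eqxx mul1r big1 ?addr0 // => w wz.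
by rewrite eq_sym (negPf wz) mul0r.
Qed.

Lemma sum_eqr1 (w : S) (F : S -> R) : \sum_z F z * (z == w)%:R = F w.
Proof.
rewrite -[RHS](sum_eq1 w F); apply: eq_bigr => z _.
by rewrite mulrC eq_sym.
Qed.

Lemma resample_kernel {th p} : 0 <= th <= 1 -> is_distr p -> is_kernel (resample th p).
Proof.
move=> /andP[th0 th1] [p0 p1] z; split=> [w|].
  by rewrite addr_ge0 ?mulr_ge0 ?subr_ge0.
rewrite big_split -!mulr_sumr p1 /=.
under eq_bigr do rewrite -[_%:R]mulr1.
by rewrite (sum_eq1 z (fun=> 1)) !mulr1 subrK.
Qed.

(** One redraw erases the past, so the start is remembered only on the event of no redraw in [k]
    steps, of probability [(1 - th) ^+ k]. *)
Lemma kpow_resample {th p} k z w : is_distr p ->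
  kpow (resample th p) k z w = (1 - th) ^+ k * (z == w)%:R + (1 - (1 - th) ^+ k) * p w.
Proof.
move=> [p0 p1]; elim: k w => [|k IH] w /=; first by rewrite expr0 subrr mul0r mul1r addr0.
under eq_bigr do rewrite IH /resample.
rewrite (eq_bigr (fun u => (z == u)%:R * ((1 - th) ^+ k * ((1 - th) * (u == w)%:R + th * p w))
    + (1 - (1 - th) ^+ k) * ((1 - th) * (p u * (u == w)%:R) + th * p w * p u))); last first.
  by move=> u _; ring.
rewrite big_split /= sum_eq1 -mulr_sumr big_split /= -!mulr_sumr p1 sum_eqr1 exprS.
by ring.
Qed.

Lemma resample_unique {th p} : 0 < th -> is_distr p -> unique_invariant (resample th p) p.
Proof.
move=> th0 dp; have E q w : is_distr q ->
    \sum_z q z * resample th p z w = (1 - th) * q w + th * p w.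
  move=> [_ q1]; rewrite (eq_bigr (fun z =>
    (1 - th) * (q z * (z == w)%:R) + th * p w * q z)); last by move=> z _; rewrite /resample; ring.
  by rewrite big_split /= -!mulr_sumr q1 sum_eqr1 mulr1.
split=> //; split=> [w|q dq inv z]; first by rewrite E //; ring.
have := inv z; rewrite E // => /(congr1 (fun x => x - (1 - th) * q z)) H.
by apply: (mulfI (lt0r_neq0 th0)); move: H; rewrite addrC addKr => ->; ring.
Qed.

Lemma resample_mixing {th p} (tau : nat) : 0 <= th <= 1 -> is_distr p ->
  (1 - th) ^+ tau <= 1 / 4 -> mixing (resample th p) tau.
Proof.
move=> /andP[th0 th1] dp hth k z z'; have th1' : 0 <= 1 - th by rewrite subr_ge0.
have le_pow : (1 - th) ^+ k <= (1 / 4) ^+ (k %/ tau).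
  rewrite {1}(divn_eq k tau) exprD mulnC exprM -[leRHS]mulr1.
  have h2 : ((1 - th) ^+ tau) ^+ (k %/ tau) <= (1 / 4) ^+ (k %/ tau).
    by apply: lerXn2r hth; rewrite nnegrE ?exprn_ge0 ?divr_ge0.
  have h3 : (1 - th) ^+ (k %% tau) <= 1 by rewrite exprn_ile1 // gerBl.
  exact: ler_pM (exprn_ge0 _ (exprn_ge0 _ th1')) (exprn_ge0 _ th1') h2 h3.
apply: le_trans le_pow; rewrite ler_pdivrMr // /tv_norm.
(* The redrawn parts of the two laws cancel; a difference of two point masses remains, of norm at
   most 2. *)
under eq_bigr => w _ do rewrite !kpow_resample // opprD addrACA subrr addr0 -mulrBr normrM.
rewrite -mulr_sumr ger0_norm ?exprn_ge0 // ler_wpM2l ?exprn_ge0 //.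
apply: le_trans (_ : \sum_w ((z == w)%:R * 1 + (z' == w)%:R * 1) <= _).
  apply: ler_sum => w _; rewrite !mulr1; apply: le_trans (ler_normB _ _) _.
  by rewrite !ger0_norm.
by rewrite big_split /= !(sum_eq1 _ (fun=> 1)); lra.
Qed.

Lemma sum_tuple_cons n (F : seq S -> R) :
  \sum_(t : n.+1.-tuple S) F t = \sum_z \sum_(t : n.-tuple S) F (z :: t).
Proof.
rewrite pair_big /= (reindex (fun zt : S * n.-tuple S => [tuple of zt.1 :: zt.2])) //=.
exists (fun t => (thead t, [tuple of behead t])) => [[z t] _|t _] /=.
  by congr pair; apply: val_inj.
by rewrite -tuple_eta.
Qed.

(** The row sum [r] is left free because [biased_two_point] uses this, through [sum_traj_prob], for
    a kernel whose rows may sum to less than 1. *)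
Lemma sum_chain_weight (K : S -> S -> R) r : (forall z, \sum_w K z w = r) ->
  forall n z, \sum_(t : n.-tuple S) chain_weight K z t = r ^+ n.
Proof.
move=> Kr; elim=> [|n IH] z.
  by rewrite (big_pred1 [tuple]) // => t; apply/esym/eqP/tuple0.
rewrite sum_tuple_cons /= exprS -{1}(Kr z) mulr_suml.
by apply: eq_bigr => w _; rewrite -mulr_sumr IH.
Qed.

Lemma chain_weight_ge0 (K : S -> S -> R) z t : (forall z w, 0 <= K z w) ->
  0 <= chain_weight K z t.
Proof. by move=> K0; elim: t z => [|w t IH] z //=; rewrite mulr_ge0. Qed.

Lemma traj_prob_ge0 p (K : S -> S -> R) t : (forall z, 0 <= p z) ->
  (forall z w, 0 <= K z w) -> 0 <= traj_prob p K t.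
Proof. by move=> p0 K0; case: t => [|z t] //=; rewrite mulr_ge0 ?chain_weight_ge0. Qed.

Lemma sum_traj_prob p (K : S -> S -> R) r : (forall z, \sum_w K z w = r) ->
  forall n, \sum_(t : n.+1.-tuple S) traj_prob p K t = \sum_z p z * r ^+ n.
Proof.
move=> Kr n; rewrite sum_tuple_cons; apply: eq_bigr => z _ /=.
by rewrite -mulr_sumr (sum_chain_weight K r).
Qed.

Lemma sum_traj_prob1 p (K : S -> S -> R) n : is_distr p -> is_kernel K ->
  \sum_(t : n.-tuple S) traj_prob p K t = 1.
Proof.
move=> [_ p1] K1; case: n => [|n].
  by rewrite (big_pred1 [tuple]) // => t; apply/esym/eqP/tuple0.
rewrite (sum_traj_prob _ _ 1) => [|z]; last by have [] := K1 z.
by rewrite -mulr_suml p1 mul1r expr1n.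
Qed.

End Resampling.

(** * The redraw probability and its mixing time *)

Section Rate.
Context {R : realType}.

(** Chosen so that [1 - refresh tau] is the inverse of [1 + 3 / tau], whose [tau]-th power is at
    least 4 by Bernoulli's inequality. *)
Definition refresh (tau : nat) : R := 3 / (tau%:R + 3).

Variables (tau : nat).
Hypothesis tau0 : (0 < tau)%N.
Lemma period_ge1 : 1 <= tau%:R :> R.
Proof. by rewrite ler1n. Qed.

Lemma refresh_gt0 : 0 < refresh tau.
Proof. have ? := period_ge1; by rewrite divr_gt0 //; lra. Qed.

Lemma refresh_le : refresh tau <= 3 / 4.
Proof. have ? := period_ge1; by rewrite ler_pdivrMr; lra. Qed.

Lemma refresh_le_inv : refresh tau <= 3 / tau%:R.
Proof. have ? := period_ge1; by rewrite ler_pM2l // lef_pV2 ?posrE; lra. Qed.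

Lemma refresh_01 : 0 <= refresh tau <= 1.
Proof. by rewrite ltW ?refresh_gt0 //=; have := refresh_le; lra. Qed.

Lemma bernoulli (x : R) n : 0 <= 1 + x -> 1 + n%:R * x <= (1 + x) ^+ n.
Proof.
move=> x1; elim: n => [|n IH]; first by rewrite mul0r addr0 expr0.
rewrite exprS -natr1; apply: le_trans (ler_wpM2l x1 IH).
have : 0 <= n%:R * (x * x) by rewrite mulr_ge0 // -expr2 sqr_ge0.
by lra.
Qed.

Lemma refresh_pow : (1 - refresh tau) ^+ tau <= 1 / 4.
Proof.
have ? := period_ge1; have -> : 1 - refresh tau = (1 + 3 / tau%:R)^-1.
  by rewrite /refresh; field; rewrite ?gt_eqF //=; lra.
have h : 0 <= 1 + 3 / tau%:R :> R by rewrite addr_ge0 ?divr_ge0 //; lra.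
have := bernoulli (3 / tau%:R) tau h; rewrite mulrC divfK => [H|]; last by rewrite gt_eqF; lra.
by rewrite exprVn mul1r lef_pV2 ?posrE; lra.
Qed.

End Rate.

(** * One-dimensional instances *)

Section Quadratic.
Context {R : realType}.

Lemma qgrad_exact {d} (f : 'rV[R]_d -> R) (x g : 'rV[R]_d) (C : R) :
  (forall h, f (x + h) = f x + vdot g h + C * vnorm2 h) -> qgrad f x g.
Proof.
move=> fE; exists `|C| => // h _; rewrite fE vnorm_sqr.
have -> : f x + vdot g h + C * vnorm2 h - f x - vdot g h = C * vnorm2 h by ring.
by rewrite normrM (ger0_norm (vnorm2_ge0 _)).
Qed.

Lemma strongly_convex_minimizer {d} (mu : R) (f : 'rV[R]_d -> R) g xs :
  0 <= mu -> strongly_convex mu f g -> g xs = 0 -> is_minimizer f xs.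
Proof.
move=> mu0 sc gxs x; apply: le_trans (sc xs x); rewrite gxs vdot0l addr0 lerDl.
by rewrite mulr_ge0 ?divr_ge0 ?vnorm2_ge0.
Qed.

(** Each state has an exact quadratic expansion. Averaging these expansions gives the gradient of
    [f] and strong convexity with equality, so an instance only has to check its means and its noise
    bound. *)
Lemma valid_quad {d} {S : finType} (sigma L mu : R) (tau : nat) (p : S -> R)
    (F : 'rV[R]_d -> S -> R) (gF : 'rV[R]_d -> S -> 'rV[R]_d) (C : S -> R) (u : 'rV[R]_d) :
  0 < mu -> mu < L -> (0 < tau)%N -> is_distr p ->
  (forall x z h, F (x + h) z = F x z + vdot (gF x z) h + C z * vnorm2 h) ->
  \sum_z p z * C z = mu / 2 ->
  (forall x, \sum_z p z *: gF x z = mu *: (x - u)) ->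
  (forall x z, vnorm2 (gF x z - mu *: (x - u)) <= sigma ^+ 2 + vnorm2 (mu *: (x - u))) ->
  valid_instance sigma L mu tau p (resample (refresh tau) p) F gF
    (fun x => \sum_z p z * F x z) (fun x => mu *: (x - u)) u.
Proof.
move=> mu0 muL tau0 dp FE pC pg noise.
have th01 := @refresh_01 R tau tau0.
have fE x h : \sum_z p z * F (x + h) z =
    \sum_z p z * F x z + vdot (mu *: (x - u)) h + mu / 2 * vnorm2 h.
  rewrite -pg vdot_suml -pC mulr_suml -!big_split /=; apply: eq_bigr => z _.
  by rewrite FE vdotZl; ring.
have sc : strongly_convex mu (fun x => \sum_z p z * F x z) (fun x => mu *: (x - u)).
  by move=> x y; rewrite -fE addrC subrK.
rewrite /valid_instance; repeat match goal with |- _ /\ _ => split end => //.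
- exact: resample_kernel.
- by apply: resample_unique => //; exact: refresh_gt0.
- by apply: resample_mixing => //; exact: refresh_pow.
- by move=> z; apply: qgrad_is_gradient => x; exact: qgrad_exact (FE x z).
- by apply: qgrad_is_gradient => x; exact: qgrad_exact (fE x).
- move=> x y; rewrite -scalerBr vnormZ opprB addrA subrK gtr0_norm //.
  by rewrite ler_wpM2r ?vnorm_ge0 // ltW.
- by move=> x z; rewrite expr1n mul1r.
- by apply: strongly_convex_minimizer sc _; [exact: ltW|rewrite subrr scaler0].
Qed.

Lemma expR_le_1B (x : R) : 0 <= x -> x <= 1 / 2 -> expR (- (2 * x)) <= 1 - x.
Proof.
move=> x0 x1; rewrite expRN -[leRHS]invrK lef_pV2 ?posrE ?expR_gt0 ?invr_gt0 //; last by lra.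
apply: le_trans (expR_ge1Dx (2 * x)).
rewrite -[leLHS]mul1r ler_pdivrMr; [nra|lra].
Qed.

Lemma half_distr : is_distr (fun _ : bool => 1 / 2 : R).
Proof. by split=> [z|]; rewrite ?big_bool /=; lra. Qed.

Lemma run_oracle_cst {d} {S : finType} (query : seq 'rV[R]_d -> 'rV[R]_d)
    (gF : 'rV[R]_d -> S -> 'rV[R]_d) z g n acc :
  (forall x, gF x z = g) -> run_oracle query gF (nseq n z) acc = acc ++ nseq n g.
Proof.
move=> gFz; elim: n acc => [|n IH] acc /=; first by rewrite cats0.
by rewrite gFz IH cat_rcons.
Qed.

(** An inequality, because [n] visits make only [n - 1] transitions and the empty trajectory has
    weight 1; the spare factor lets one formula cover every [n]. *)
Lemma traj_prob_cst {S : finType} (p : S -> R) (K : S -> S -> R) z n :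
  p z <= 1 -> K z z <= 1 -> 0 <= p z -> 0 <= K z z ->
  p z * K z z ^+ n <= traj_prob p K (nseq n z).
Proof.
move=> p1 K1 p0 K0; case: n => [|n] /=; first by rewrite mulr1.
rewrite ler_wpM2l //; elim: n => [|n IH]; first by rewrite /= expr1.
by rewrite exprS /= ler_wpM2l.
Qed.

(* In state [false] the oracle is silent, so until the chain first visits [true]
   the minimizers [e] and [- e] cannot be told apart. *)
Lemma silent_instance (sigma L mu : R) (tau : nat) (eps : R) (N : nat)
    (query output : forall d : nat, seq 'rV[R]_d -> 'rV[R]_d) :
  0 < mu -> mu < L -> (0 < tau)%N -> 0 < eps -> 2 <= ln (1 / eps) ->
  exists (d : nat) (S : finType) (pi : S -> R) (Q : S -> S -> R)
         (F : 'rV[R]_d -> S -> R) (gF : 'rV[R]_d -> S -> 'rV[R]_d)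
         (f : 'rV[R]_d -> R) (gf : 'rV[R]_d -> 'rV[R]_d) (xstar : 'rV[R]_d),
    [/\ valid_instance sigma L mu tau pi Q F gF f gf xstar,
        vnorm xstar <= 1 &
        (expect_traj N pi Q
           (fun zs => vnorm2 (output d (run_oracle (query d) gF zs [::]) - xstar))
           <= eps ->
         tau%:R * ln (1 / eps) / 6 <= N%:R)].
Proof.
move=> mu0 muL tau0 eps0 leps.
pose o := output 1%N (nseq N 0).
(* The squared distances from [o] to [e] and [- e] add up to [2 |o|^2 + 2], so one of them is at
   least 1. *)
have [u u1 ou] : exists2 u : 'rV[R]_1, vnorm u = 1 & 1 <= vnorm2 (o - u).
  pose e : 'rV[R]_1 := delta_mx ord0 ord0.
  have e1 : vnorm e = 1 by exact: vnorm_delta.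
  have [oe|oe] := leP 1 (vnorm2 (o - e)); first by exists e.
  exists (- e); first by rewrite vnormN.
  move: oe; rewrite opprK !vnorm2D vnorm2N vdotNr -(vnorm_sqr e) e1 expr1n.
  by have := vnorm2_ge0 o; lra.
pose p : bool -> R := fun=> 1 / 2.
pose F (x : 'rV[R]_1) (z : bool) := if z then mu * vnorm2 (x - u) else 0.
pose gF (x : 'rV[R]_1) (z : bool) := if z then (2 * mu) *: (x - u) else 0.
exists 1%N, bool, p, (resample (refresh tau) p), F, gF,
  (fun x => \sum_z p z * F x z), (fun x => mu *: (x - u)), u.
have th01 := @refresh_01 R tau tau0.
split; last 2 first; first by rewrite u1.
- move=> le_eps.
  have th0 := @refresh_gt0 R tau tau0; have th1 := @refresh_le R tau tau0.
  have ht : 1 <= tau%:R :> R by rewrite ler1n.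
  (* Only the trajectory that never leaves the silent state is kept; on it the output is [o], with
     squared error at least 1. *)
  have h1 : p false * resample (refresh tau) p false false ^+ N <= eps.
    apply: le_trans le_eps; rewrite /expect_traj (bigD1 [tuple of nseq N false]) //=.
    rewrite (run_oracle_cst _ _ _ 0) // -/o -[leLHS]addr0.
    apply: lerD; last first.
      apply: sumr_ge0 => t _; rewrite mulr_ge0 ?vnorm2_ge0 // traj_prob_ge0 //.
        by move=> z; rewrite /p; lra.
      by move=> z w; have [] := resample_kernel th01 half_distr z.
    rewrite -[leLHS]mulr1 ler_pM //.
    + by rewrite mulr_ge0 ?exprn_ge0 /resample /p /=; lra.
    + by apply: traj_prob_cst; rewrite /resample /p /=; lra.
  have h2 : expR (- refresh tau * N%:R) <= 2 * eps.
    have -> : - refresh tau * N%:R = N%:R * (- (2 * (refresh tau / 2))) :> R.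
      by field.
    rewrite expRM_natl.
    have : expR (- (2 * (refresh tau / 2))) ^+ N <= (1 - refresh tau / 2 : R) ^+ N.
      by apply: lerXn2r; rewrite ?nnegrE ?expR_ge0 ?expR_le_1B //; lra.
    move: h1; rewrite /p /resample /= mulr1.
    have -> : 1 - refresh tau + refresh tau * (1 / 2) = 1 - refresh tau / 2 :> R by field.
    by lra.
  (* The factor 2 is at most [expR 1]; the resulting 1 is then at most half of [ln (1 / eps)], by
     the assumed lower bound 2. *)
  have h3 : - refresh tau * N%:R <= 1 - ln (1 / eps).
    rewrite -ler_expR; apply: le_trans h2 _; rewrite expRD expRN lnK ?posrE ?divr_gt0 //.
    by rewrite mul1r invrK ler_wpM2r ?(ltW eps0) //; have := expR_ge1Dx (1 : R); lra.
  have h4 := @refresh_le_inv R tau tau0.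
  have h5 : refresh tau * N%:R <= 3 / tau%:R * N%:R :> R by rewrite ler_wpM2r.
  have h6 : ln (1 / eps) / 2 <= 3 / tau%:R * N%:R :> R by lra.
  rewrite -(@ler_pM2l _ (3 / tau%:R)) ?divr_gt0 //; last by lra.
  rewrite (_ : 3 / _ * _ = ln (1 / eps) / 2) //; field.
  by rewrite gt_eqF //; lra.
apply: (valid_quad _ _ _ _ _ _ _ (fun z => if z then mu else 0)) => //.
- exact: half_distr.
- move=> x [] h; rewrite /F /gF /= ?vdot0l ?mul0r ?addr0 //.
  by rewrite (addrAC x h) (vnorm2D (x - u)) vdotZl; ring.
- by rewrite big_bool /p /=; field.
- move=> x; rewrite big_bool /p /gF /= scaler0 addr0 scalerA.
  by congr (_ *: _); field.
- move=> x [] /=; last by rewrite sub0r vnorm2N lerDr sqr_ge0.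
  by rewrite -scalerBl (_ : 2 * mu - mu = mu) ?lerDr ?sqr_ge0 //; ring.
Qed.

End Quadratic.

(** * Two-point testing along trajectories *)

Section Statistical.
Context {R : realType}.

(** The bound multiplies along the path. [K] is a lower bound for the entrywise geometric mean of
    [Q1] and [Q2], kept squared to avoid roots. *)
Lemma chain_weight_sqr_le {S : finType} (K Q1 Q2 : S -> S -> R) z t :
  (forall z w, 0 <= K z w) -> (forall z w, 0 <= Q1 z w * Q2 z w) ->
  (forall z w, K z w ^+ 2 <= Q1 z w * Q2 z w) ->
  chain_weight K z t ^+ 2 <= chain_weight Q1 z t * chain_weight Q2 z t.
Proof.
move=> K0 Q0 KQ; elim: t z => [|w t IH] z /=; first by rewrite expr1n mulr1.
by rewrite exprMn (mulrACA (Q1 z w)) ler_pM ?sqr_ge0.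
Qed.

(* [g] plays the role of a Bhattacharyya coefficient: two-point testing bound
   without square roots. *)
Lemma two_point (p q g e1 e2 s : R) : 0 <= p -> 0 <= q -> 0 <= g -> g ^+ 2 <= p * q ->
  0 <= e1 -> 0 <= e2 -> 0 <= s -> s <= e1 + e2 ->
  (g - (p + q) / 4) * s <= p * e1 + q * e2.
Proof.
move=> p0 q0 g0; wlog pq : p q e1 e2 p0 q0 / p <= q => [H|] gpq e10 e20 s0 se.
  have [pq|/ltW qp] := leP p q; first exact: H.
  rewrite (addrC (p * e1)) (addrC p); apply: H => //; first by rewrite mulrC.
  by rewrite addrC.
(* The smaller weight [p] suffices: [(p + (p + q) / 4)^2 - p q] equals
   [((3 p - q)^2 + 16 p^2) / 16]. *)
have gp : g - (p + q) / 4 <= p.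
  have : g ^+ 2 <= (p + (p + q) / 4) ^+ 2.
    apply: le_trans gpq _; have := sqr_ge0 (3 * p - q).
    by rewrite !expr2; nra.
  by rewrite ler_pXn2r ?nnegrE //; lra.
apply: le_trans (ler_wpM2r s0 gp) _; apply: le_trans (ler_wpM2l p0 se) _.
by rewrite mulrDr lerD2l ler_wpM2r.
Qed.

Definition biased (beta : R) (b z : bool) : R := 1 / 2 + (if z (+) b then - beta else beta).

Lemma biased_distr beta b : 0 <= beta <= 1 / 4 -> is_distr (biased beta b).
Proof.
move=> /andP[beta0 beta4]; split=> [z|]; first by rewrite /biased; case: ifP => _; lra.
by rewrite big_bool /biased; case: b => /=; lra.
Qed.

(** [two_point] is summed over trajectories: the quarter terms add up to 1/2, and the affinity of
    the two laws is at least [1 - 4 beta^2 - 4 th beta^2 N]. A step costs only [th beta^2] because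
    it redraws with probability [th]. *)
Lemma biased_two_point (th beta s : R) N (e : bool -> seq bool -> R) :
  0 < th -> th <= 3 / 4 -> 0 <= beta <= 1 / 4 -> 0 <= s ->
  (forall b t, 0 <= e b t) -> (forall t, s <= e true t + e false t) ->
  (1 / 2 - 4 * beta ^+ 2 - 4 * (th * beta ^+ 2) * N%:R) * s <=
  expect_traj N (biased beta true) (resample th (biased beta true)) (e true) +
  expect_traj N (biased beta false) (resample th (biased beta false)) (e false).
Proof.
move=> th0 th1 beta04 sge0 e0 se; have [beta0 beta4] := andP beta04.
pose p := biased beta.
have dp b : is_distr (p b) by exact: biased_distr.
have th01 : 0 <= th <= 1 by apply/andP; split; lra.
pose P b := traj_prob (p b) (resample th (p b)).
have Q0 b z w : 0 <= resample th (p b) z w by have [] := resample_kernel th01 (dp b) z.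
have P0 b t : 0 <= P b t by apply: traj_prob_ge0 => // z; have [] := dp b.
have beta2 : beta ^+ 2 <= 1 / 16.
  have : beta ^+ 2 <= (1 / 4) ^+ 2 by rewrite ler_pXn2r ?nnegrE //; lra.
  by rewrite [in X in _ <= X -> _]expr2; lra.
(* Off the diagonal, [sqrt (1 - 4 beta^2)] is rounded down to [1 - 4 beta^2]. On it, a loss of
   [2 th beta^2] keeps the square below the product; every row then sums to [1 - 4 th beta^2]. *)
pose K (z w : bool) : R :=
  if z (+) w then th / 2 * (1 - 4 * beta ^+ 2) else 1 - th / 2 - 2 * th * beta ^+ 2.
pose k (z : bool) : R := 1 / 2 * (1 - 4 * beta ^+ 2).
have thb : th * beta ^+ 2 <= beta ^+ 2 by rewrite ler_piMl ?sqr_ge0 //; lra.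
have thb0 : 0 <= th * beta ^+ 2 by rewrite mulr_ge0 ?sqr_ge0 // ltW.
have K0 z w : 0 <= K z w.
  by rewrite /K; case: ifP => _; [rewrite mulr_ge0 //; lra|lra].
have k0 z : 0 <= k z by rewrite /k; lra.
have sq4 : (1 - 4 * beta ^+ 2) ^+ 2 <= 1 - 4 * beta ^+ 2.
  by rewrite expr2 ler_piMl //; have := sqr_ge0 beta; lra.
have KQ z w : K z w ^+ 2 <= resample th (p true) z w * resample th (p false) z w.
  rewrite /K /resample; have -> : (z == w) = ~~ (z (+) w) by case: z; case: w.
  case: ifP => _ /=.
    have -> : ((1 - th) * 0 + th * p true w) * ((1 - th) * 0 + th * p false w) =
        (th / 2) ^+ 2 * (1 - 4 * beta ^+ 2) by rewrite /p /biased; case: w => /=; field.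
    by rewrite exprMn ler_wpM2l ?sqr_ge0.
  have -> : ((1 - th) * 1 + th * p true w) * ((1 - th) * 1 + th * p false w) =
      (1 - th / 2) ^+ 2 - th * (th * beta ^+ 2) by rewrite /p /biased; case: w => /=; field.
  set y := th * _ in thb thb0 *.
  have -> : 1 - th / 2 - 2 * th * beta ^+ 2 = 1 - th / 2 - 2 * y by rewrite /y mulrA.
  by clearbody y; nra.
have GP t : traj_prob k K t ^+ 2 <= P true t * P false t.
  case: t => [|z t]; first by rewrite /P /= expr1n mulr1.
  rewrite /P /= exprMn (mulrACA (p true z)) ler_pM ?sqr_ge0 //; last first.
    by apply: chain_weight_sqr_le => // z' w; rewrite mulr_ge0.
  have -> : p true z * p false z = (1 / 2) ^+ 2 * (1 - 4 * beta ^+ 2).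
    by rewrite /p /biased; case: z => /=; field.
  by rewrite exprMn ler_wpM2l ?sqr_ge0.
have G1 : 1 - 4 * beta ^+ 2 - 4 * (th * beta ^+ 2) * N%:R <=
    \sum_(t : N.-tuple bool) traj_prob k K t.
  have Kr z : \sum_w K z w = 1 + - (4 * (th * beta ^+ 2)).
    by rewrite big_bool /K; case: z => /=; field.
  case: (N) => [|n].
    rewrite (big_pred1 [tuple]) => [/=|t]; last exact/esym/eqP/tuple0.
    by rewrite mulr0; have := sqr_ge0 beta; lra.
  rewrite (sum_traj_prob _ _ _ Kr) big_bool /k /=.
  have HB : 0 <= 1 + - (4 * (th * beta ^+ 2)) -> 1 + n%:R * - (4 * (th * beta ^+ 2)) <=
      (1 + - (4 * (th * beta ^+ 2))) ^+ n by exact: bernoulli.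
  have y0 : 0 <= 4 * (th * beta ^+ 2) by lra.
  have nE : n.+1%:R = n%:R + 1 :> R by rewrite natr1.
  move: HB y0; rewrite nE.
  set y : R := 4 * (th * beta ^+ 2); set B : R := (1 - y) ^+ n => HB y0.
  have h0 : 0 <= 1 - y by rewrite /y; lra.
  have {}HB := HB h0.
  have n0 : 0 <= n%:R * y by rewrite mulr_ge0.
  have := sqr_ge0 beta => b0.
  have : (1 - 4 * beta ^+ 2) * (1 + n%:R * - y) <= (1 - 4 * beta ^+ 2) * B.
    by rewrite ler_wpM2l //; lra.
  have : 0 <= 4 * beta ^+ 2 * (n%:R * y) by rewrite mulr_ge0 //; lra.
  by clearbody y B; lra.
have G2 : \sum_(t : N.-tuple bool) (traj_prob k K t - (P true t + P false t) / 4) =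
    \sum_(t : N.-tuple bool) traj_prob k K t - 1 / 2.
  rewrite sumrB; congr (_ - _); rewrite -mulr_suml big_split /=.
  by rewrite !sum_traj_prob1 //; [field|exact: resample_kernel|exact: resample_kernel].
apply: le_trans (_ : (\sum_(t : N.-tuple bool) traj_prob k K t - 1 / 2) * s <= _).
  by rewrite ler_wpM2r //; lra.
rewrite -G2 /expect_traj -big_split mulr_suml /=; apply: ler_sum => t _.
by apply: two_point => //; exact: traj_prob_ge0.
Qed.

(* The two signs of [b] give the same oracle answers [mu x -/+ sigma / 2] with
   slightly different frequencies, and minimizers at distance [2 a]. *)
Lemma statistical_instance (sigma L mu : R) (tau : nat) (eps : R) (N : nat)
    (query output : forall d : nat, seq 'rV[R]_d -> 'rV[R]_d) :
  0 < sigma -> 0 < mu -> mu < L -> (0 < tau)%N -> 0 < eps -> 8 * eps <= 1 ->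
  1024 * (mu ^+ 2 * eps) <= sigma ^+ 2 ->
  exists (d : nat) (S : finType) (pi : S -> R) (Q : S -> S -> R)
         (F : 'rV[R]_d -> S -> R) (gF : 'rV[R]_d -> S -> 'rV[R]_d)
         (f : 'rV[R]_d -> R) (gf : 'rV[R]_d -> 'rV[R]_d) (xstar : 'rV[R]_d),
    [/\ valid_instance sigma L mu tau pi Q F gF f gf xstar,
        vnorm xstar <= 1 &
        (expect_traj N pi Q
           (fun zs => vnorm2 (output d (run_oracle (query d) gF zs [::]) - xstar))
           <= eps ->
         tau%:R * sigma ^+ 2 / (mu ^+ 2 * eps) / 384 <= N%:R)].
Proof.
move=> sigma0 mu0 muL tau0 eps0 eps8 hsig.
(* The minimizers [a e] and [- a e] make the two squared errors add up to at least
   [2 a^2 = 16 eps]. *)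
pose a : R := Num.sqrt (8 * eps).
have a0 : 0 <= a by exact: sqrtr_ge0.
have a2 : a ^+ 2 = 8 * eps by rewrite sqr_sqrtr //; lra.
have a1 : a <= 1 by rewrite -(@expr_le1 _ 2) // a2.
(* The bias for which the noise has mean [sigma * beta = mu * a] up to sign, which puts the
   minimizer at distance [a] from 0. *)
pose beta := mu * a / sigma.
have beta0 : 0 <= beta by rewrite divr_ge0 ?mulr_ge0 // ltW.
have beta2 : beta ^+ 2 = 8 * (mu ^+ 2 * eps) / sigma ^+ 2.
  by rewrite expr_div_n exprMn a2; congr (_ / _); ring.
have beta128 : beta ^+ 2 <= 1 / 128.
  by rewrite beta2 ler_pdivrMr ?exprn_gt0 //; lra.
have beta4 : beta <= 1 / 4.
  have : beta ^+ 2 <= (1 / 4) ^+ 2 by rewrite [leRHS]expr2; lra.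
  by rewrite ler_pXn2r ?nnegrE //; lra.
have sb : sigma * beta = mu * a by rewrite mulrC divfK // gt_eqF.
pose e : 'rV[R]_1 := delta_mx ord0 ord0.
have e1 : vnorm2 e = 1 by rewrite -vnorm_sqr vnorm_delta expr1n.
have beta04 : 0 <= beta <= 1 / 4 by rewrite beta0.
pose p := biased beta.
have dp b : is_distr (p b) by exact: biased_distr.
pose xi (z : bool) := if z then - (sigma / 2) else sigma / 2.
pose u (b : bool) := (if b then a else - a) *: e.
pose F (x : 'rV[R]_1) (z : bool) := mu / 2 * vnorm2 x + xi z * vdot e x.
pose gF (x : 'rV[R]_1) (z : bool) := mu *: x + xi z *: e.
have th0 := @refresh_gt0 R tau tau0; have th1 := @refresh_le R tau tau0.
have th01 := @refresh_01 R tau tau0.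
set th : R := refresh tau in th0 th1 th01.
pose out zs := output 1%N (run_oracle (query 1%N) gF zs [::]).
pose E b := expect_traj N (p b) (resample th (p b)) (fun zs => vnorm2 (out zs - u b)).
have EN : E true <= eps -> E false <= eps ->
    tau%:R * sigma ^+ 2 / (mu ^+ 2 * eps) / 384 <= N%:R.
  move=> Et Ef.
  have ht : 1 <= tau%:R :> R by rewrite ler1n.
  (* If both errors are at most [eps], the testing coefficient is at most
     [2 eps / (16 eps) = 1 / 8], while [4 beta^2 <= 1 / 32]. *)
  have G3 : 1 / 4 <= 4 * (th * beta ^+ 2) * N%:R.
    have e0 b t : 0 <= vnorm2 (out t - u b) by exact: vnorm2_ge0.
    have s0 : 0 <= 16 * eps by lra.
    have se t : 16 * eps <= vnorm2 (out t - u true) + vnorm2 (out t - u false).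
      rewrite /u; set o := out t.
      rewrite !vnorm2D !vnorm2N !vdotNr !vnorm2Z !vdotZr e1 sqrrN a2.
      by have := vnorm2_ge0 o; lra.
    have := biased_two_point th beta _ N (fun b t => vnorm2 (out t - u b)) th0 th1 beta04 s0 e0 se.
    move/le_trans/(_ (lerD Et Ef)) => H.
    have : (1 / 2 - 4 * beta ^+ 2 - 4 * (th * beta ^+ 2) * N%:R) <= 1 / 8.
      by rewrite -(@ler_pM2r _ (16 * eps)); lra.
    by lra.
  have G4 : th * (beta ^+ 2 * N%:R) <= 3 / tau%:R * (beta ^+ 2 * N%:R).
    by apply: ler_wpM2r (refresh_le_inv _ tau0); rewrite mulr_ge0 ?sqr_ge0.
  have G5 : 1 / 4 <= 12 / tau%:R * (beta ^+ 2 * N%:R) by lra.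
  have q0 : 0 < mu ^+ 2 * eps by rewrite mulr_gt0 ?exprn_gt0.
  have s0 : 0 < sigma ^+ 2 by rewrite exprn_gt0.
  rewrite -(@ler_pM2l _ (12 / tau%:R * beta ^+ 2)); last first.
    by rewrite mulr_gt0 ?divr_gt0 // ?beta2 ?divr_gt0 ?mulr_gt0 //; lra.
  rewrite -[leRHS]mulrA; apply: le_trans G5.
  rewrite beta2 le_eqVlt; apply/orP; left; apply/eqP; field.
  by rewrite !gt_eqF //; lra.
have valid b : valid_instance sigma L mu tau (p b) (resample th (p b)) F gF
    (fun x => \sum_z p b z * F x z) (fun x => mu *: (x - u b)) (u b).
  apply: (valid_quad _ _ _ _ _ _ _ (fun=> mu / 2)) => //.
  - by move=> x z h; rewrite /F /gF vnorm2D vdotDr vdotDl !vdotZl; field.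
  - by rewrite -mulr_suml; have [_ ->] := dp b; rewrite mul1r.
  - move=> x; rewrite /gF.
    under eq_bigr do rewrite scalerDr scalerA.
    rewrite big_split /= -scaler_suml -mulr_suml; have [_ ->] := dp b.
    rewrite mul1r scalerBr; congr (_ + _).
    rewrite big_bool /= !scalerA -scalerDl -scaleNr; congr (_ *: _).
    by rewrite /p /biased /xi; case: b => /=; lra.
  - move=> x z; have -> : gF x z - mu *: (x - u b) =
        (xi z + mu * (if b then a else - a)) *: e.
      by rewrite /gF /u scalerBr scalerA scalerDl opprB (addrC (mu *: x)) -addrA subrKC.
    rewrite (vnorm2Z (xi z + _)) e1 mulr1; apply: ler_wpDr; first exact: vnorm2_ge0.
    rewrite -(real_normK (num_real (_ + _))) ler_pXn2r ?nnegrE ?normr_ge0 ?(ltW sigma0) //.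
    have : sigma * beta <= sigma * (1 / 4) by rewrite ler_wpM2l // ltW.
    have : 0 <= sigma * beta by rewrite mulr_ge0 // ltW.
    rewrite sb /xi ler_norml => h1 h2; clear -sigma0 h1 h2.
    by case: z; case: b; apply/andP; split; lra.
have u1 b : vnorm (u b) <= 1.
  by rewrite vnormZ vnorm_delta mulr1; case: b; rewrite ?normrN ger0_norm.
(* If the method fails for [true], that instance makes the implication vacuous; otherwise [false] is
   taken, and success there means success on both. *)
pose b := ~~ (E true <= eps).
exists 1%N, bool, (p b), (resample th (p b)), F, gF,
  (fun x => \sum_z p b z * F x z), (fun x => mu *: (x - u b)), (u b).
split=> //; rewrite -/(E b) {}/b.
by have [Et /= Ef|Et /=] := boolP (E true <= eps); [exact: EN|rewrite (negPf Et)].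
Qed.

End Statistical.

(** * The chain quadratic and its masking perturbation *)

Section Shift.
Context {R : realType} {n : nat}.
Implicit Types y z : 'rV[R]_n.+1.

(** For [i : 'I_n], [lo i] has value [i] and [hi i] has value [i.+1]: a pair of consecutive
    coordinates. *)
Notation lo := (lift ord_max).
Notation hi := (lift ord0).

Definition shiftr y : 'rV[R]_n.+1 :=
  \row_j (if unlift ord0 j is Some i then y ord0 (lo i) else 0).
Definition shiftl y : 'rV[R]_n.+1 :=
  \row_j (if unlift ord_max j is Some i then y ord0 (hi i) else 0).

Lemma vdot_shift y z : vdot (shiftr y) z = vdot y (shiftl z).
Proof.
rewrite /vdot (bigD1_ord ord0) // (bigD1_ord ord_max) //= !mxE !unlift_none mul0r mulr0.
by congr (_ + _); apply: eq_bigr => i _; rewrite !mxE !liftK.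
Qed.

Lemma vnorm_shiftr y : vnorm (shiftr y) <= vnorm y.
Proof.
rewrite ler_wsqrtr // /vnorm2 /vdot (bigD1_ord ord0) // [leRHS](bigD1_ord ord_max) //=.
apply: lerD; first by rewrite mxE unlift_none mul0r -expr2 sqr_ge0.
by apply: ler_sum => i _; rewrite !mxE !liftK.
Qed.

Lemma vnorm_shiftl y : vnorm (shiftl y) <= vnorm y.
Proof.
rewrite ler_wsqrtr // /vnorm2 /vdot (bigD1_ord ord_max) // [leRHS](bigD1_ord ord0) //=.
apply: lerD; first by rewrite mxE unlift_none mul0r -expr2 sqr_ge0.
by apply: ler_sum => i _; rewrite !mxE !liftK.
Qed.

Definition upto (l : nat) y := forall j : 'I_n.+1, (l <= j)%N -> y ord0 j = 0.

Variable q : R.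
Hypothesis q01 : 0 < q < 1.

Definition bidiag y : 'rV[R]_n.+1 := y - q *: shiftr y.
Definition bidiagT y : 'rV[R]_n.+1 := y - q *: shiftl y.

Lemma bidiagT_coord z j : bidiagT z ord0 j =
  z ord0 j - q * (if unlift ord_max j is Some i then z ord0 (hi i) else 0).
Proof. by rewrite !mxE. Qed.

Lemma bidiagD y z : bidiag (y + z) = bidiag y + bidiag z.
Proof.
rewrite /bidiag addrACA -opprD -scalerDr; congr (_ - _ *: _).
by apply/rowP => j; rewrite !mxE; case: unlift => [i|]; rewrite ?mxE ?addr0.
Qed.

Lemma bidiagTB y z : bidiagT y - bidiagT z = bidiagT (y - z).
Proof.
apply/rowP => j; rewrite !mxE; case: unlift => [i|]; rewrite ?mxE; ring.
Qed.

Lemma vdot_bidiag y z : vdot (bidiag y) z = vdot y (bidiagT z).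
Proof. by rewrite vdotDl vdotDr vdotNl vdotNr vdotZl vdotZr vdot_shift. Qed.

Lemma bidiag_bounds y : (1 - q) * vnorm y <= vnorm (bidiag y) <= (1 + q) * vnorm y.
Proof.
have [q0 q1] := andP q01; have h : q * vnorm (shiftr y) <= q * vnorm y.
  by rewrite ler_pM2l // vnorm_shiftr.
have := ler_vnormD y (- (q *: shiftr y)); have := ler_vnormD (bidiag y) (q *: shiftr y).
rewrite subrK vnormN vnormZ (gtr0_norm q0) => h1 h2.
by apply/andP; split; [lra|apply: le_trans h2 _; lra].
Qed.

Lemma bidiagT_bounds y : (1 - q) * vnorm y <= vnorm (bidiagT y) <= (1 + q) * vnorm y.
Proof.
have [q0 q1] := andP q01; have h : q * vnorm (shiftl y) <= q * vnorm y.
  by rewrite ler_pM2l // vnorm_shiftl.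
have := ler_vnormD y (- (q *: shiftl y)); have := ler_vnormD (bidiagT y) (q *: shiftl y).
rewrite subrK vnormN vnormZ (gtr0_norm q0) => h1 h2.
by apply/andP; split; [lra|apply: le_trans h2 _; lra].
Qed.

(** The future minimizer, a truncated geometric sequence; the square root gives the untruncated
    sequence norm 1. *)
Definition geo : 'rV[R]_n.+1 := \row_j (Num.sqrt (1 - q ^+ 2) * q ^+ j).

Lemma sub1_sqr_gt0 : 0 < 1 - q ^+ 2.
Proof. by have [q0 q1] := andP q01; rewrite expr2; nra. Qed.

Lemma geo_sqr j : geo ord0 j ^+ 2 = (1 - q ^+ 2) * q ^+ (2 * j).
Proof. by rewrite mxE exprMn sqr_sqrtr ?ltW ?sub1_sqr_gt0 // -exprM mulnC. Qed.

Lemma vnorm_geo : vnorm geo <= 1.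
Proof.
have [q0 q1] := andP q01.
apply: vnorm_le => //; rewrite /vnorm2 /vdot expr1n.
under eq_bigr do rewrite -expr2 geo_sqr.
have -> : \sum_(j < n.+1) (1 - q ^+ 2) * q ^+ (2 * j) = 1 - q ^+ (2 * n.+1).
  elim: n.+1 => [|m IH]; first by rewrite big_ord0 muln0 expr0 subrr.
  by rewrite big_ord_recr /= IH mulnS exprD; ring.
by rewrite gerBl exprn_ge0 // ltW.
Qed.

(** The missed coordinates of [geo] have squares that telescope to the left side, which is
    non-positive once [l] exceeds the dimension. *)
Lemma geo_tail_dist l y : upto l y -> q ^+ (2 * l) - q ^+ (2 * n.+1) <= vnorm2 (y - geo).
Proof.
move=> yl; have [q0 q1] := andP q01; have qq := sub1_sqr_gt0.
apply: le_trans (_ : \sum_(j < n.+1) (if (l <= j)%N then (1 - q ^+ 2) * q ^+ (2 * j) else 0) <= _).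
  elim: n.+1 => [|m IH].
    by rewrite big_ord0 muln0 expr0 subr_le0 exprn_ile1 ?ltW.
  rewrite big_ord_recr /=; have [lm|ml] := leqP l m.
    by rewrite mulnS exprD; move: IH; lra.
  apply: le_trans (_ : 0 <= _).
    rewrite subr_le0; have := ml; rewrite -(leq_pmul2l (isT : 0 < 2)%N) => h.
    by rewrite -(subnK h) exprD ler_piMl ?exprn_ge0 ?exprn_ile1 // ltW.
  rewrite addr0 sumr_ge0 // => j _; case: ifP => // _.
  by rewrite mulr_ge0 ?exprn_ge0 // ltW.
apply: ler_sum => j _; rewrite -expr2; case: ifP => [lj|_]; last exact: sqr_ge0.
by rewrite -geo_sqr !mxE yl // sub0r sqrrN.
Qed.

(** [geo] solves the recurrence at every coordinate but the first, so it leaves a trace only in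
    coordinate 0 of the residual. *)
Lemma resid_hi y i : bidiag (y - geo) ord0 (hi i) = y ord0 (hi i) - q * y ord0 (lo i).
Proof. by rewrite !mxE liftK !mxE lift0 lift_max (exprS q i); ring. Qed.

End Shift.

(** * The chain quadratic, its mask and the progress of a level *)

Section Chain.
Context {R : realType} {n : nat}.
Variables (c q r : R).
Hypotheses (c0 : 0 < c) (q01 : 1 / 2 <= q < 1) (r0 : 0 < r).
Implicit Types y h : 'rV[R]_n.+1.

Notation lo := (lift ord_max).
Notation hi := (lift ord0).
Notation mu := (c * (1 - q) ^+ 2).

Let q0 : 0 < q. Proof. by have [? _] := andP q01; lra. Qed.
Let q1 : q < 1. Proof. by have [] := andP q01. Qed.
Let q01' : 0 < q < 1. Proof. by rewrite q0 q1. Qed.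

Definition chain_f y : R := c / 2 * vnorm2 (bidiag q (y - geo q)).
Definition chain_g y : 'rV[R]_n.+1 := c *: bidiagT q (bidiag q (y - geo q)).

Lemma chain_fD y h :
  chain_f (y + h) = chain_f y + vdot (chain_g y) h + c / 2 * vnorm2 (bidiag q h).
Proof.
rewrite /chain_f /chain_g (addrAC y h) (bidiagD q (y - geo q)) vnorm2D vdotZl.
rewrite (vdotC (bidiagT _ _)) -vdot_bidiag.
by rewrite (vdotC (bidiag q h)); field.
Qed.

Lemma chain_qgrad y : qgrad chain_f y (chain_g y).
Proof.
exists (c / 2 * (1 + q) ^+ 2) => [|h _].
  by rewrite mulr_ge0 ?sqr_ge0 // divr_ge0 // ltW.
have -> : chain_f (y + h) - chain_f y - vdot (chain_g y) h = c / 2 * vnorm2 (bidiag q h).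
  by rewrite chain_fD; ring.
have [_ hb] := andP (bidiag_bounds _ q01' h).
rewrite ger0_norm ?mulr_ge0 ?vnorm2_ge0 ?divr_ge0 ?(ltW c0) // -(mulrA (c / 2)) ler_wpM2l //.
  by rewrite divr_ge0 // ltW.
by rewrite -vnorm_sqr -exprMn ler_pXn2r ?nnegrE ?vnorm_ge0 // mulr_ge0 ?vnorm_ge0 //; have := q0; lra.
Qed.

Lemma chain_convex : strongly_convex mu chain_f chain_g.
Proof.
move=> x y; have -> : chain_f y = chain_f (x + (y - x)) by rewrite addrC subrK.
rewrite chain_fD lerD2l.
have [hb _] := andP (bidiag_bounds _ q01' (y - x)).
rewrite (mulrAC c) -(mulrA (c / 2)) ler_wpM2l ?divr_ge0 ?(ltW c0) //.
rewrite -!vnorm_sqr -exprMn ler_pXn2r ?nnegrE ?vnorm_ge0 //.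
by rewrite mulr_ge0 ?vnorm_ge0 //; have := q1; lra.
Qed.

Lemma chain_smooth L : 4 * c <= L -> L_smooth L chain_g.
Proof.
move=> cL x y; rewrite /chain_g -scalerBr bidiagTB vnormZ (gtr0_norm c0).
have -> : bidiag q (x - geo q) - bidiag q (y - geo q) = bidiag q (x - y).
  have -> : x - geo q = (x - y) + (y - geo q) by rewrite addrA subrK.
  by rewrite bidiagD addrK.
have [_ h1] := andP (bidiagT_bounds _ q01' (bidiag q (x - y))).
have [_ h2] := andP (bidiag_bounds _ q01' (x - y)).
have v0 := vnorm_ge0 (x - y); have := q0; have := q1 => q1' q0'.
have h3 : (1 + q) * vnorm (bidiag q (x - y)) <= 2 * (2 * vnorm (x - y)).
  by apply: ler_pM; rewrite ?vnorm_ge0 //; [lra|lra|apply: le_trans h2 _; rewrite ler_wpM2r //; lra].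
have h4 := ler_wpM2l (ltW c0) (le_trans h1 h3).
by apply: le_trans h4 _; have := ler_wpM2r v0 cL; lra.
Qed.

Lemma chain_g_lower y : mu * vnorm (y - geo q) <= vnorm (chain_g y).
Proof.
rewrite vnormZ (gtr0_norm c0) -mulrA ler_wpM2l ?(ltW c0) //.
have [h1 _] := andP (bidiagT_bounds _ q01' (bidiag q (y - geo q))).
have [h2 _] := andP (bidiag_bounds _ q01' (y - geo q)).
by apply: le_trans h1; rewrite expr2 -mulrA ler_wpM2l // subr_ge0 ltW.
Qed.

Lemma chain_g_geo : chain_g (geo q) = 0.
Proof.
apply: vnorm_eq0; apply/eqP; rewrite eq_le vnorm_ge0 andbT /chain_g subrr.
have [_ h1] := andP (bidiagT_bounds _ q01' (bidiag q (0 : 'rV[R]_n.+1))).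
have [_ h2] := andP (bidiag_bounds _ q01' (0 : 'rV[R]_n.+1)).
rewrite vnorm0 mulr0 in h2.
have h3 : (1 + q) * vnorm (bidiag q (0 : 'rV[R]_n.+1)) <= 0.
  by rewrite pmulr_rle0 //; have := q0; lra.
by rewrite vnormZ pmulr_rle0 ?normr_gt0 ?gt_eqF //; apply: le_trans h1 h3.
Qed.

(** When the coordinates from [hi i] on vanish, [chain_g] has entry [- c q y_(lo i)] at [hi i]; term
    [i] contributes the same amount there with sign [(-1) ^+ i], so adding or subtracting [mask_f]
    cancels or doubles it. *)
Definition mask_f y : R :=
  \sum_(i < n) ((-1) ^+ i * (c * q)) * (y ord0 (lo i) * gate r (hi i) y).

Definition mask_term y (i : 'I_n) : 'rV[R]_n.+1 :=
  gate r (hi i) y *: delta_mx ord0 (lo i) + y ord0 (lo i) *: ggate r (hi i) y.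

Definition mask_g y : 'rV[R]_n.+1 :=
  \sum_(i < n) ((-1) ^+ i * (c * q)) *: mask_term y i.

Lemma mask_qgrad y : qgrad mask_f y (mask_g y).
Proof.
apply: qgrad_sum => i; apply: qgradZ.
by apply: qgradM; [exact: qgrad_coord|exact: gate_qgrad].
Qed.

Lemma vnorm_mask_term y i t : `|y ord0 (hi i)| <= t ->
  vnorm (mask_term y i) <= t + `|y ord0 (lo i)| * vnorm (ggate r (hi i) y).
Proof.
move=> yt; apply: le_trans (ler_vnormD _ _) _; rewrite !vnormZ vnorm_delta mulr1 lerD2r.
exact: le_trans (gate_le _ _ _ r0) yt.
Qed.

Lemma mask_term_eq0 y i : r <= vnorm (tail (hi i) y) -> mask_term y i = 0.
Proof. by move=> ry; rewrite /mask_term gate_eq0 // ggate_eq0 // scaler0 scale0r addr0. Qed.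

(** Coordinate [hi i] of [chain_g] is [- c q y_(lo i)] plus terms in coordinates from [hi i] on,
    each bounded through [u]. *)
Lemma chain_g_hi y i (u := vnorm (tail (hi i) y)) :
  (c * q) * `|y ord0 (lo i)| - 3 * c * u <= vnorm (chain_g y).
Proof.
have u0 : 0 <= u by exact: vnorm_ge0.
have tl (j : 'I_n.+1) : (hi i <= j)%N -> `|y ord0 j| <= u by exact: ler_coord_tail.
apply: le_trans (ler_coord_vnorm _ (hi i)).
rewrite mxE normrM (gtr0_norm c0) (mulrC 3) -!mulrA -mulrBr ler_pM2l //.
rewrite bidiagT_coord resid_hi.
set z := (X in _ - q * X).
have zu : `|z| <= 2 * u.
  rewrite /z; case: unliftP => [j ij|_]; last by rewrite normr0 mulr_ge0.
  rewrite resid_hi; apply: le_trans (ler_normB _ _) _.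
  have h1 : `|y ord0 (hi j)| <= u.
    by apply: tl; rewrite ij lift0 lift_max.
  have h2 : `|q * y ord0 (lo j)| <= u.
    rewrite normrM (gtr0_norm q0); apply: le_trans (_ : `|y ord0 (lo j)| <= _).
      by rewrite ler_piMl // ltW.
    by apply: tl; rewrite ij.
  by lra.
have h3 : `|y ord0 (hi i)| <= u by exact: tl.
have h4 : `|q * z| <= 2 * u.
  by rewrite normrM (gtr0_norm q0); apply: le_trans zu; rewrite ler_piMl // ltW.
set w := y ord0 (hi i) - _ - _.
have : `|y ord0 (hi i) - q * z - w| <= `|y ord0 (hi i)| + `|q * z| + `|w|.
  apply: le_trans (ler_normB _ _) _; rewrite lerD2r; exact: ler_normB.
have -> : y ord0 (hi i) - q * z - w = q * y ord0 (lo i) by rewrite /w; ring.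
by rewrite normrM (gtr0_norm q0); lra.
Qed.

(** The smallest entry of [geo] stands on the right: within distance [r] of the masked subspaces,
    [chain_g] still dominates a mask of size [c q (6 n + 15) r]. *)
Hypothesis r_small :
  r * (mu + (c * q) * (6 * n%:R + 15)) <= mu * (Num.sqrt (1 - q ^+ 2) * q ^+ n).

(** Take the least [i] whose cutoff is active. The other terms are at most [2 u] each. If
    [|y_(lo i)|] is large, the decrease of [ggate] beats these terms and the loss in [chain_g_hi];
    if it is small, the whole mask is of order [r] and the distance to [geo] suffices. *)
Lemma mask_le y : vnorm (mask_g y) <= vnorm (chain_g y).
Proof.
have [[i0 i0P]|none] := pselect (exists i : 'I_n, vnorm (tail (hi i) y) < r); last first.
  rewrite /mask_g big1 ?vnorm0 ?vnorm_ge0 // => i _; rewrite mask_term_eq0 ?scaler0 //.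
  by rewrite leNgt; apply/negP => ir; apply: none; exists i.
case: (@arg_minnP _ i0 (fun i => vnorm (tail (hi i) y) < r) (fun i : 'I_n => i : nat) i0P) => i ir imin {i0 i0P}.
set b := c * q; have b0 : 0 < b by rewrite mulr_gt0 // q0.
set u := vnorm (tail (hi i) y) in ir.
have u0 : 0 <= u by exact: vnorm_ge0.
have tl (j : 'I_n.+1) : (hi i <= j)%N -> `|y ord0 j| <= u by exact: ler_coord_tail.
have hi_u : `|y ord0 (hi i)| <= u by exact: tl.
set x := `|y ord0 (lo i)|; have x0 : 0 <= x by exact: normr_ge0.
have other (j : 'I_n) : j != i -> vnorm (mask_term y j) <= 2 * u.
  move=> ji; have [jr|rj] := ltP (vnorm (tail (hi j) y)) r; last first.
    by rewrite mask_term_eq0 // vnorm0 mulr_ge0.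
  have ij : (i < j)%N by rewrite ltn_neqAle eq_sym ji imin.
  have hj : `|y ord0 (hi j)| <= u by apply: tl; rewrite !lift0 ltnS ltnW.
  apply: le_trans (vnorm_mask_term _ _ _ hj) _.
  rewrite mulr_natl mulr2n lerD2l -[leRHS]mulr1.
  apply: ler_pM; rewrite ?vnorm_ge0 ?vnorm_ggate_le1 //.
  by apply: tl; rewrite lift0 lift_max.
have up : vnorm (mask_g y) <= b * (x * (1 - u / r / 2)) + (2 * n%:R + 1) * (b * u).
  apply: le_trans (ler_vnorm_sum _ _ _ _) _.
  rewrite (eq_bigr (fun j => b * vnorm (mask_term y j))); last first.
    move=> j _; rewrite vnormZ normrM normrX normrN1 expr1n mul1r.
    by rewrite gtr0_norm.
  rewrite -mulr_sumr (bigD1 i) //=.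
  have h1 : vnorm (mask_term y i) <= u + x * (1 - u / r / 2).
    apply: le_trans (vnorm_mask_term _ _ _ hi_u) _; rewrite lerD2l ler_wpM2l //.
    by rewrite vnorm_ggate // ltW.
  have h2 : \sum_(j | j != i) vnorm (mask_term y j) <= n%:R * (2 * u).
    apply: le_trans (_ : \sum_(j < n) 2 * u <= _); last first.
      by rewrite sumr_const card_ord -[_ *+ n]mulr_natl.
    rewrite [leRHS](bigD1 i) //=; apply: ler_wpDl; first by rewrite mulr_ge0.
    exact: ler_sum.
  by have := ler_wpM2l (ltW b0) (lerD h1 h2); lra.
have cb : c <= 2 * b.
  by have [qh _] := andP q01; have := ler_wpM2l (ltW c0) qh; rewrite /b; lra.
have n0 : 0 <= n%:R :> R by [].
(* [4 n + 14] is twice [(2 n + 1) + 6]: the cross terms, and [3 c u <= 6 b u] from [chain_g_hi]. *)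
have [big|small] := leP (r * (4 * n%:R + 14)) x.
  apply: le_trans up _; apply: le_trans (chain_g_hi y i); rewrite -/u -/x -/b.
  have h : (4 * n%:R + 14) * u <= x * (u / r).
    by rewrite mulrA mulrAC ler_wpM2r // ler_pdivlMr // mulrC.
  have := ler_wpM2r u0 cb; have := ler_wpM2l (ltW b0) h.
  by move=> ? ?; lra.
apply: le_trans up _; apply: le_trans (chain_g_lower y).
have h1 : x * (1 - u / r / 2) <= r * (4 * n%:R + 14).
  apply: le_trans (ltW small); rewrite ler_piMr // gerBl !divr_ge0 // ltW //.
have h2 : b * (x * (1 - u / r / 2)) + (2 * n%:R + 1) * (b * u) <= r * (b * (6 * n%:R + 15)).
  have := ler_wpM2l (ltW b0) h1.
  have : (2 * n%:R + 1) * (b * u) <= (2 * n%:R + 1) * (b * r).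
    by rewrite ler_wpM2l ?addr_ge0 ?mulr_ge0 // ler_pM2l // ltW.
  by lra.
apply: le_trans h2 _.
have mu0 : 0 <= mu by rewrite mulr_ge0 ?sqr_ge0 // ltW.
apply: le_trans (_ : mu * (Num.sqrt (1 - q ^+ 2) * q ^+ n - r) <= _).
  by move: r_small; rewrite -/b; lra.
rewrite ler_wpM2l //; apply: le_trans (ler_coord_vnorm _ (hi i)).
have -> : (y - geo q) ord0 (hi i) = y ord0 (hi i) - geo q ord0 (hi i) by rewrite !mxE.
have h3 : Num.sqrt (1 - q ^+ 2) * q ^+ n <= geo q ord0 (hi i).
  rewrite mxE ler_wpM2l ?sqrtr_ge0 // ler_wiXn2l ?(ltW q0) ?(ltW q1) //.
  by rewrite lift0.
have := ler_norm (geo q ord0 (hi i)).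
have h4 : `|y ord0 (hi i)| < r by exact: le_lt_trans ir.
have := ler_normD (y ord0 (hi i) - geo q ord0 (hi i)) (- y ord0 (hi i)).
rewrite addrAC subrr add0r !normrN.
by lra.
Qed.

(** The level bounds the discovered coordinates; [z (+) odd l] says that state [z] masks coordinate
    [l]. *)
Definition advance (l : nat) (z : bool) := if z (+) odd l then l else l.+1.

(** Only neighbouring coordinates interact, so coordinate [l] alone could become nonzero. Level 0 is
    excluded because coordinate 0 sees the minimizer without any mask. *)
Lemma chain_progress l y z : (0 < l)%N -> upto l y ->
  upto (advance l z) (chain_g y + (-1) ^+ z *: mask_g y).
Proof.
move=> l0 yl j lj.
have lej : (l <= j)%N by apply: leq_trans lj; rewrite /advance; case: ifP.
case: (unliftP ord0 j) => [i ji|j0]; last by rewrite j0 leqNgt l0 in lej.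
have Dg : chain_g y ord0 j = - (c * q) * y ord0 (lo i).
  rewrite mxE bidiagT_coord.
  have -> : (if unlift ord_max j is Some k then bidiag q (y - geo q) ord0 (hi k) else 0) = 0.
    case: unliftP => // k jk; rewrite resid_hi !yl ?mulr0 ?subrr //.
      by rewrite -jk.
    by rewrite lift0; apply: leq_trans lej _; rewrite jk lift_max.
  by rewrite ji resid_hi yl -?ji //; ring.
have Dm : mask_g y ord0 j =
    (-1) ^+ i * (c * q) * (y ord0 (lo i) * cutoff r j y ^+ 2).
  rewrite summxE (bigD1 i) //= big1 => [|k ki].
    rewrite addr0 [LHS]mxE; congr (_ * _); rewrite !mxE -ji.
    by rewrite /gate yl // !mul0r !mulr0 !mul0r subr0 add0r !eqxx mulr1.
  rewrite [LHS]mxE [X in _ * X](_ : _ = 0) ?mulr0 // mxE [X in X + _]mxE [X in _ + X]mxE.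
  have -> : gate r (hi k) y * (delta_mx ord0 (lo k) : 'rV[R]_n.+1) ord0 j = 0.
    rewrite mxE eqxx /=; case: eqP => [jk|_]; last by rewrite mulr0.
    rewrite /gate yl ?mul0r // lift0; apply: leq_trans lej _.
    by rewrite jk lift_max.
  rewrite add0r; have [lk|kl] := leqP l k.
    by rewrite yl ?mul0r // lift_max.
  have -> : ggate r (hi k) y ord0 j = 0; last by rewrite mulr0.
  rewrite !mxE (yl j lej) if_same mulr0 subr0 eqxx /= ji (inj_eq (@lift_inj _ ord0)).
  by rewrite eq_sym (negPf ki) mulr0.
rewrite [LHS]mxE [X in _ + X]mxE Dg Dm.
have [li|il] := leqP l i; first by rewrite yl ?lift_max //; ring.
have jE : j = l :> nat.
  by apply/eqP; rewrite eqn_leq lej ji lift0 il.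
(* The tail from [l] on is zero, so the cutoff is exactly 1 and the cancellation is exact. *)
have -> : cutoff r j y = 1.
  rewrite /cutoff (_ : tail j y = 0) ?vnorm0 ?mul0r ?subr0.
    by apply/max_idPr; rewrite ler01.
  by apply/rowP => k; rewrite !mxE; case: ifP => // jk; rewrite yl // -jE.
move: lj; rewrite jE /advance; case: ifP => [zl _|_]; last by rewrite ltnn.
have -> : (-1) ^+ z = (-1) ^+ i :> R.
  rewrite -(signr_odd _ i); congr (_ ^+ _).
  by move: zl; rewrite -jE ji lift0 /=; case: z; case: odd.
by rewrite expr1n mulr1 !mulrA -expr2 sqrr_sign; ring.
Qed.

End Chain.

(** * Embedding along an adversarial orthonormal family *)

Section Lift.
Context {R : realType} {d m : nat}.
Variables (mu : R) (V : 'M[R]_(d, m)).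
Implicit Types (x h : 'rV[R]_d) (a b : 'rV[R]_m).

(** For orthonormal columns, the second summand is [mu / 2] times the squared distance to their
    span, so the new directions have curvature [mu]. *)
Definition lift_f (f : 'rV[R]_m -> R) x : R :=
  f (x *m V) + mu / 2 * (vnorm2 x - vnorm2 (x *m V)).
Definition lift_g (g : 'rV[R]_m -> 'rV[R]_m) x : 'rV[R]_d :=
  g (x *m V) *m V^T + mu *: (x - x *m V *m V^T).

Hypothesis VV : V^T *m V = 1%:M.

Lemma embK a : a *m V^T *m V = a.
Proof. by rewrite -mulmxA VV mulmx1. Qed.

Lemma vdot_emb a x : vdot (a *m V^T) x = vdot a (x *m V).
Proof. by rewrite vdot_mulmx trmxK. Qed.

Lemma vnorm2_emb a : vnorm2 (a *m V^T) = vnorm2 a.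
Proof. by rewrite /vnorm2 vdot_emb embK. Qed.

Lemma vdot_perp a x : vdot (a *m V^T) (x - x *m V *m V^T) = 0.
Proof. by rewrite vdot_emb mulmxBl embK subrr vdotC vdot0l. Qed.

Lemma vdot_perp_proj x h :
  vdot (x - x *m V *m V^T) h = vdot x h - vdot (x *m V) (h *m V).
Proof. by rewrite vdotDl vdotNl vdot_emb. Qed.

Lemma vnorm2_perp x : vnorm2 (x - x *m V *m V^T) = vnorm2 x - vnorm2 (x *m V).
Proof.
have PV : (x - x *m V *m V^T) *m V = 0 by rewrite mulmxBl embK subrr.
rewrite [LHS]vdot_perp_proj PV (vdotC (x *m V)) vdot0l subr0 vdotC.
exact: vdot_perp_proj.
Qed.

Lemma vnorm2_proj_le x : vnorm2 (x *m V) <= vnorm2 x.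
Proof. by rewrite -subr_ge0 -vnorm2_perp vnorm2_ge0. Qed.

Lemma vnorm_proj_le x : vnorm (x *m V) <= vnorm x.
Proof. by rewrite ler_wsqrtr // vnorm2_proj_le. Qed.

Lemma vnorm2_lift a x :
  vnorm2 (a *m V^T + mu *: (x - x *m V *m V^T)) =
  vnorm2 a + mu ^+ 2 * (vnorm2 x - vnorm2 (x *m V)).
Proof. by rewrite vnorm2D vnorm2_emb vdotZr vdot_perp !mulr0 addr0 vnorm2Z vnorm2_perp. Qed.

Lemma lift_fD f g x h :
  lift_f f (x + h) - lift_f f x - vdot (lift_g g x) h =
  f (x *m V + h *m V) - f (x *m V) - vdot (g (x *m V)) (h *m V)
  + mu / 2 * (vnorm2 h - vnorm2 (h *m V)).
Proof.
rewrite /lift_f /lift_g mulmxDl !vnorm2D vdotDl vdot_emb vdotZl vdot_perp_proj.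
by field.
Qed.

Lemma lift_qgrad f g x : 0 <= mu ->
  qgrad f (x *m V) (g (x *m V)) -> qgrad (lift_f f) x (lift_g g x).
Proof.
move=> mu0 [C C0 H]; exists (C + mu / 2) => [|h h1]; first by rewrite addr_ge0 ?divr_ge0.
rewrite lift_fD mulrDl; apply: le_trans (ler_normD _ _) (lerD _ _).
  apply: le_trans (H _ (le_trans (vnorm_proj_le h) h1)) _.
  by rewrite ler_wpM2l // ler_pXn2r ?nnegrE ?vnorm_ge0 ?vnorm_proj_le.
rewrite ger0_norm ?mulr_ge0 ?divr_ge0 ?subr_ge0 ?vnorm2_proj_le //.
by rewrite ler_wpM2l ?divr_ge0 // vnorm_sqr gerBl vnorm2_ge0.
Qed.

Lemma lift_convex f g : strongly_convex mu f g -> strongly_convex mu (lift_f f) (lift_g g).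
Proof.
move=> sc x y; have := lift_fD f g x (y - x); rewrite -mulmxDl.
rewrite (addrC x (y - x)) subrK => E.
have := sc (x *m V) (y *m V); rewrite -mulmxBl => h.
rewrite -subr_ge0; move: h; rewrite -subr_ge0 => h.
by apply: le_trans h _; lra.
Qed.

Lemma lift_smooth L g : 0 <= mu -> mu <= L -> L_smooth L g -> L_smooth L (lift_g g).
Proof.
move=> mu0 muL sm x y; have L0 := le_trans mu0 muL.
apply: vnorm_le; first by rewrite mulr_ge0 ?vnorm_ge0.
have -> : lift_g g x - lift_g g y = (g (x *m V) - g (y *m V)) *m V^T
    + mu *: ((x - y) - (x - y) *m V *m V^T).
  rewrite /lift_g !mulmxBl opprD addrACA -scalerBr; congr (_ + _ *: _).
  by rewrite !opprD addrACA.
rewrite vnorm2_lift exprMn vnorm_sqr -[vnorm2 (_ - _)]vnorm_sqr.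
have h1 := sm (x *m V) (y *m V); rewrite -mulmxBl in h1.
have h2 : vnorm (g (x *m V) - g (y *m V)) ^+ 2 <= L ^+ 2 * vnorm2 ((x - y) *m V).
  by rewrite -vnorm_sqr -exprMn ler_pXn2r ?nnegrE ?mulr_ge0 ?vnorm_ge0.
have h3 : mu ^+ 2 <= L ^+ 2 by rewrite ler_pXn2r ?nnegrE.
have h4 : 0 <= vnorm2 (x - y) - vnorm2 ((x - y) *m V) by rewrite subr_ge0 vnorm2_proj_le.
have := ler_wpM2r h4 h3.
by lra.
Qed.

End Lift.

(** * Orthonormal columns chosen against a given method *)

Section Resisting.
Context {R : realType}.

Lemma exists_orthogonal_unit {d} (s : seq 'rV[R]_d) : (size s < d)%N ->
  exists2 v : 'rV[R]_d, vnorm2 v = 1 & forall x, x \in s -> vdot x v = 0.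
Proof.
move=> sd; pose A : 'M[R]_(d, size s) := \matrix_(i, j) (nth 0 s j) ord0 i.
have : kermx A != 0.
  rewrite kermx_eq0 /row_free neq_ltn (leq_ltn_trans _ sd) //; exact: rank_leq_col.
case/rowV0Pn => v /sub_kermxP vA vN0.
have v0 : 0 < vnorm2 v.
  by rewrite lt_def vnorm2_ge0 andbT; apply: contraNneq vN0 => /vnorm2_eq0 ->.
have s0 : 0 < vnorm v by rewrite sqrtr_gt0.
exists ((vnorm v)^-1 *: v) => [|x xs].
  by rewrite vnorm2Z -vnorm_sqr -exprMn mulVf ?expr1n // gt_eqF.
have xi : (index x s < size s)%N by rewrite index_mem.
rewrite vdotZr vdotC; apply/eqP; rewrite mulf_eq0; apply/orP; right; apply/eqP.
have /rowP/(_ (Ordinal xi)) := vA; rewrite !mxE => vAx.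
by rewrite -[RHS]vAx; apply: eq_bigr => i _; rewrite mxE /= nth_index.
Qed.

Context {d n : nat}.
Local Notation m := n.+1.
Implicit Types V W : 'M[R]_(d, m).

Definition colv V (j : 'I_m) : 'rV[R]_d := \row_i V i j.
Definition first_cols (k : nat) V : 'M[R]_(d, m) :=
  \matrix_(i, j) (if (j < k)%N then V i j else 0).

Lemma mulmx_colv (x : 'rV[R]_d) V j : (x *m V) ord0 j = vdot x (colv V j).
Proof. by rewrite mxE; apply: eq_bigr => i _; rewrite mxE. Qed.

(** Columns are picked one at a time. The points that column [k] must avoid depend only on the
    earlier columns, hence survive later choices, and [D + m < d] leaves a free direction at each
    stage. *)
Lemma orthonormal_avoiding (pts : 'M[R]_(d, m) -> seq 'rV[R]_d) (D : nat) :
  (forall V, size (pts V) <= D)%N -> (D + m < d)%N ->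
  exists V, V^T *m V = 1%:M /\
    forall (k : 'I_m) x, x \in pts (first_cols k V) -> (x *m V) ord0 k = 0.
Proof.
move=> ptsD Dd.
have partial (k : nat) : (k <= m)%N -> exists V,
    [/\ forall i (j : 'I_m), (k <= j)%N -> V i j = 0,
      forall i j : 'I_m, (i < k)%N -> (j < k)%N -> vdot (colv V i) (colv V j) = (i == j)%:R &
      forall (l : 'I_m) x, (l < k)%N -> x \in pts (first_cols l V) -> vdot x (colv V l) = 0];
    last first.
  have [V [_ gV hV]] := partial m (leqnn _).
  exists V; split=> [|k x xk]; last by rewrite mulmx_colv hV.
  apply/matrixP => i j; rewrite !mxE -gV //.
  by apply: eq_bigr => l _; rewrite !mxE.
elim: k => [_|k IH km].
  by exists 0; split=> // i j; rewrite mxE.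
have [V [zV gV hV]] := IH (ltnW km).
have VE : first_cols k V = V.
  by apply/matrixP => i j; rewrite mxE; case: ltnP => // /zV ->.
have [|v v1 vL] := @exists_orthogonal_unit d (pts V ++ [seq colv V j | j <- enum 'I_m]).
  rewrite size_cat size_map size_enum_ord; apply: leq_ltn_trans Dd.
  by rewrite leq_add2r.
pose V' : 'M[R]_(d, m) := \matrix_(i, j) (if j == k :> nat then v ord0 i else V i j).
have cV' (j : 'I_m) : colv V' j = if j == k :> nat then v else colv V j.
  by apply/rowP => i; rewrite !mxE; case: ifP => // _; rewrite ?mxE.
have fV' (l : nat) : (l <= k)%N -> first_cols l V' = first_cols l V.
  move=> lk; apply/matrixP => i j; rewrite !mxE; case: ltnP => // jl.
  by rewrite ltn_eqF // (leq_trans jl).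
have vV j : vdot (colv V j) v = 0.
  by apply: vL; rewrite mem_cat map_f ?orbT // mem_enum.
exists V'; split=> [i j kj|i j ik jk|l x lk].
- by rewrite mxE gtn_eqF // zV // ltnW.
- rewrite !cV' -val_eqE /=.
  have [ik'|ik'] := eqVneq (i : nat) k; have [jk'|jk'] := eqVneq (j : nat) k.
  + by rewrite -/(vnorm2 v) v1 ik' jk' eqxx.
  + by rewrite vdotC vV ik' eq_sym (negPf jk').
  + by rewrite vV jk' (negPf ik').
  + by rewrite gV // ltn_neqAle ?ik' ?jk' -ltnS.
- rewrite fV' // cV'; case: eqP => [->|/eqP lk'].
    by rewrite VE => xV; apply: vL; rewrite mem_cat xV.
  by apply: hV; rewrite ltn_neqAle lk' -ltnS.
Qed.

Lemma run_oracle_rcons {S : finType} (query : seq 'rV[R]_d -> 'rV[R]_d)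
    (gF : 'rV[R]_d -> S -> 'rV[R]_d) s z acc (h := run_oracle query gF s acc) :
  run_oracle query gF (rcons s z) acc = rcons h (gF (query h) z).
Proof. by rewrite /h; elim: s acc {h} => [|w s IH] acc //=. Qed.

(* Column [k] of [V] is chosen orthogonal to every point produced when all columns
   of index at least [k] are replaced by 0; a run at level at most [k] does not
   notice this replacement. *)
Lemma resisting_basis (mu : R) (G : 'rV[R]_m -> bool -> 'rV[R]_m) (N : nat)
    (query output : seq 'rV[R]_d -> 'rV[R]_d) :
  (forall l y z, (0 < l)%N -> upto l y -> upto (advance l z) (G y z)) ->
  (2 * (\sum_(k < N.+1) 2 ^ k) + m < d)%N ->
  exists2 V, V^T *m V = 1%:M & forall s, (size s <= N)%N ->
    upto (foldl advance 1%N s)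
      (output (run_oracle query (fun x z => lift_g mu V (G^~ z) x) s [::]) *m V).
Proof.
move=> Gup Dd.
pose gF V x z := lift_g mu V (G^~ z) x.
pose hist V s := run_oracle query (gF V) s [::].
(* The method is deterministic, so its points over all state sequences of length at most [N] form a
   finite list: one query and one output per sequence. *)
pose strings := flatten [seq [seq tval t | t <- enum {: (nat_of_ord k).-tuple bool}] | k <- enum 'I_N.+1].
have strings_size : size strings = (\sum_(k < N.+1) 2 ^ k)%N.
  rewrite size_flatten /shape -map_comp sumnE big_map big_enum /=.
  by apply: eq_bigr => k _; rewrite size_map -cardE card_tuple card_bool.
have stringsP s : (size s <= N)%N -> s \in strings.
  rewrite -ltnS => sN; apply/flatten_mapP; exists (Ordinal sN); first by rewrite mem_enum.
  by apply/mapP; exists (in_tuple s); rewrite ?mem_enum.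
pose pts V := [seq query (hist V s) | s <- strings] ++ [seq output (hist V s) | s <- strings].
have [|V [VV Vpts]] := orthonormal_avoiding pts _ _ Dd.
  by move=> V; rewrite size_cat !size_map strings_size mul2n addnn.
exists V => //.
pose lev s := foldl advance 1%N s.
have lev0 s : (0 < lev s)%N.
  rewrite /lev; elim/last_ind: s => // s z IH; rewrite foldl_rcons /advance.
  by case: ifP.
have cols (l k : nat) (y : 'rV[R]_m) : (l <= k)%N -> upto l y ->
    y *m (first_cols k V)^T = y *m V^T.
  move=> lk yl; apply/rowP => i; rewrite !mxE; apply: eq_bigr => j _; rewrite !mxE.
  by case: ltnP => // kj; rewrite yl ?mul0r // (leq_trans lk).
have proj (l k : nat) (x : 'rV[R]_d) : (l <= k)%N -> upto l (x *m V) ->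
    x *m first_cols k V = x *m V.
  move=> lk xl; apply/rowP => j; have [jk|kj] := ltnP j k.
    by rewrite !mxE; apply: eq_bigr => i _; rewrite mxE jk.
  rewrite [RHS]xl ?(leq_trans lk) // mxE big1 // => i _.
  by rewrite mxE ltnNge kj mulr0.
(* For [j] at or above the level, the point is also produced with the columns from [j] on erased,
   and column [j] was chosen orthogonal to that point. *)
have hidden (p : seq 'rV[R]_d -> 'rV[R]_d) s :
    (forall W, p (hist W s) \in pts W) ->
    (forall k, (lev s <= k)%N -> hist (first_cols k V) s = hist V s) ->
    upto (lev s) (p (hist V s) *m V).
  by move=> ps hs j lj; apply: Vpts; rewrite -(hs j lj).
have qpts s W : (size s <= N)%N -> query (hist W s) \in pts W.
  by move=> /stringsP sN; rewrite mem_cat; apply/orP; left; apply/mapP; exists s.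
have opts s W : (size s <= N)%N -> output (hist W s) \in pts W.
  by move=> /stringsP sN; rewrite mem_cat; apply/orP; right; apply/mapP; exists s.
(* Induction on the run: the query lies below the level, hence so does the answer up to the new
   level, and neither sees the erased columns. *)
have stable s : (size s <= N)%N ->
    forall k, (lev s <= k)%N -> hist (first_cols k V) s = hist V s.
  elim/last_ind: s => [|s z IH] // sN k.
  have {}sN : (size s <= N)%N by move: sN; rewrite size_rcons => /ltnW.
  rewrite /lev foldl_rcons -/(lev s) => levk.
  have lk : (lev s <= k)%N.
    by apply: leq_trans levk; rewrite /advance; case: ifP.
  rewrite /hist !run_oracle_rcons -/(hist _ s) -/(hist _ s) IH //; congr rcons.
  have up : upto (lev s) (query (hist V s) *m V).
    by apply: hidden => [W|]; [exact: qpts|exact: IH].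
  rewrite /gF /lift_g (proj _ _ _ lk up) (cols _ _ _ lk up).
  by rewrite (cols _ _ _ levk (Gup _ _ _ (lev0 s) up)).
by move=> s sN; apply: hidden => [W|]; [exact: opts|exact: stable].
Qed.

End Resisting.

(** * The accelerated term *)

Section ChainInstance.
Context {R : realType}.

(* After each step the current state is the one that masks the next coordinate,
   so the level increases exactly when the chain switches state. *)
Lemma stuck_expectation (th a : R) l z n : z (+) odd l ->
  \sum_(t : n.-tuple bool)
     chain_weight (resample th (fun=> 1 / 2)) z t * a ^+ foldl advance l t =
  a ^+ l * (1 - th / 2 + th / 2 * a) ^+ n.
Proof.
elim: n l z => [|n IH] l z zl.
  rewrite (big_pred1 [tuple]) => [|t]; first by rewrite /= mul1r mulr1.
  exact/esym/eqP/tuple0.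
rewrite (sum_tuple_cons n (fun t : seq bool => chain_weight _ z t * a ^+ foldl advance l t)) /=.
have E w : w (+) odd (advance l w) by rewrite /advance; case: w; case El: (odd l); rewrite /= ?El.
rewrite (eq_bigr (fun w => resample th (fun=> 1 / 2) z w *
    (a ^+ advance l w * (1 - th / 2 + th / 2 * a) ^+ n))); last first.
  by move=> w _; rewrite -(IH _ w (E w)) mulr_sumr; apply: eq_bigr => t _; rewrite mulrA.
rewrite big_bool /= /advance /resample.
by move: zl; case: z; case: (odd l) => //= _; rewrite !exprS; field.
Qed.

(** The first state may already raise the level from 1 to 2; from then on [stuck_expectation]
    applies. Exponents 2 and [N] leave slack that covers both cases and [N = 0]. *)
Lemma level_expectation (th a : R) N : 0 <= th <= 1 -> 0 <= a <= 1 ->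
  a ^+ 2 * (1 - th / 2 + th / 2 * a) ^+ N <=
  \sum_(t : N.-tuple bool)
    traj_prob (fun=> 1 / 2) (resample th (fun=> 1 / 2)) t * a ^+ foldl advance 1%N t.
Proof.
move=> /andP[th0 th1] /andP[a0 a1].
case: N => [|n].
  rewrite (big_pred1 [tuple]) => [|t]; last exact/esym/eqP/tuple0.
  by rewrite /= mul1r mulr1 expr2 expr1 ler_piMl.
rewrite (sum_tuple_cons n (fun t : seq bool => traj_prob _ _ t * a ^+ foldl advance 1%N t)) /=.
set rho := _ + _; have rho01 : 0 <= rho <= 1 by apply/andP; rewrite /rho; split; nra.
have [rho0 rho1] := andP rho01.
rewrite (eq_bigr (fun w => 1 / 2 * (a ^+ advance 1 w * rho ^+ n))); last first.
  move=> w _; rewrite -(stuck_expectation th a (advance 1 w) w n); last by case: w.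
  by rewrite mulr_sumr; apply: eq_bigr => t _; rewrite mulrA.
rewrite big_bool /= expr1 (exprS rho).
have A0 : 0 <= rho ^+ n by exact: exprn_ge0.
have h : rho * rho ^+ n <= rho ^+ n by rewrite ler_piMl.
have h2 : a ^+ 2 * (rho * rho ^+ n) <= a ^+ 2 * rho ^+ n by rewrite ler_wpM2l ?exprn_ge0.
have h3 : a ^+ 2 * rho ^+ n <= a * rho ^+ n by rewrite ler_wpM2r // expr2 ler_piMl.
by lra.
Qed.

Lemma exists_expn_le (q eps : R) : 0 < q < 1 -> 0 < eps -> exists n : nat, q ^+ n <= eps.
Proof.
move=> /andP[q0 q1] eps0; have d0 : 0 < q^-1 - 1 by rewrite subr_gt0 invf_gt1.
pose n := Num.bound (eps^-1 / (q^-1 - 1)); exists n.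
have hn : eps^-1 / (q^-1 - 1) < n%:R by apply: archi_boundP; rewrite divr_ge0 ?ltW // invr_gt0.
have := @bernoulli R (q^-1 - 1) n _; rewrite addrC subrK => H.
have {}H : n%:R * (q^-1 - 1) + 1 <= q^-1 ^+ n.
  by rewrite addrC; apply: H; rewrite invr_ge0 ltW.
rewrite ltr_pdivrMr // in hn.
rewrite -[leRHS]invrK -[leLHS]invrK lef_pV2 ?posrE ?invr_gt0 ?exprn_gt0 //.
by rewrite -exprVn; lra.
Qed.

(** Since [q >= 1 / 2], the prefactor is at least 1/16, and the base is at least [1 - th dl]. Then
    [32 <= expR 5], and 5 is at most half of [ln (1 / eps)]. *)
Lemma geometric_rate (th dl eps : R) (N : nat) (q := 1 - dl) :
  0 < th -> th <= 3 / 4 -> 0 < dl -> dl <= 1 / 2 -> 0 < eps -> 10 <= ln (1 / eps) ->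
  (q ^+ 2) ^+ 2 * (1 - th / 2 + th / 2 * q ^+ 2) ^+ N <= 2 * eps ->
  ln (1 / eps) / 2 <= N%:R * (2 * (th * dl)).
Proof.
move=> th0 th1 dl0 dlh eps0 leps h3; have qh1 : 1 / 2 <= q by rewrite /q; lra.
have q2h : 1 / 4 <= q ^+ 2 by rewrite expr2; nra.
have q4h : 1 / 16 <= (q ^+ 2) ^+ 2 by rewrite [leRHS]expr2; nra.
have tdl : th * dl <= 1 / 2.
  have : th * dl <= 3 / 4 * (1 / 2) by rewrite ler_pM // ltW.
  by lra.
have h4 : (1 - th * dl) ^+ N <= 32 * eps.
  have base : 1 - th * dl <= 1 - th / 2 + th / 2 * q ^+ 2.
    rewrite /q expr2; have := mulr_ge0 (ltW th0) (mulr_ge0 (ltW dl0) (ltW dl0)).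
    by lra.
  have h : (1 - th * dl) ^+ N <= (1 - th / 2 + th / 2 * q ^+ 2) ^+ N.
    by apply: lerXn2r => //; rewrite nnegrE; lra.
  have hp : 0 <= (1 - th / 2 + th / 2 * q ^+ 2) ^+ N.
    by apply: le_trans h; rewrite exprn_ge0 //; lra.
  by have := ler_wpM2r hp q4h; lra.
have td0 : 0 <= th * dl by rewrite mulr_ge0 // ltW.
have h5 : expR (N%:R * - (2 * (th * dl))) <= 32 * eps.
  apply: le_trans h4; rewrite expRM_natl.
  by apply: lerXn2r; rewrite ?nnegrE ?expR_ge0 ?expR_le_1B //; lra.
have e5 : 32 <= expR 5 :> R.
  have -> : 5 = 5%:R * 1 :> R by rewrite mulr1.
  have -> : 32 = 2 ^+ 5 :> R by rewrite -natrX.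
  rewrite expRM_natl.
  by apply: lerXn2r; rewrite ?nnegrE ?expR_ge0 //; have := expR_ge1Dx (1 : R); lra.
have h6 : N%:R * - (2 * (th * dl)) <= 5 - ln (1 / eps).
  rewrite -ler_expR; apply: le_trans h5 _; rewrite expRD expRN lnK ?posrE ?divr_gt0 //.
  by rewrite mul1r invrK ler_wpM2r // ltW.
by lra.
Qed.

Lemma chain_instance (sigma L mu : R) (tau : nat) (eps : R) (N : nat)
    (query output : forall d : nat, seq 'rV[R]_d -> 'rV[R]_d) :
  0 < mu -> 16 * mu <= L -> (0 < tau)%N -> 0 < eps -> 10 <= ln (1 / eps) ->
  exists (d : nat) (S : finType) (pi : S -> R) (Q : S -> S -> R)
         (F : 'rV[R]_d -> S -> R) (gF : 'rV[R]_d -> S -> 'rV[R]_d)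
         (f : 'rV[R]_d -> R) (gf : 'rV[R]_d -> 'rV[R]_d) (xstar : 'rV[R]_d),
    [/\ valid_instance sigma L mu tau pi Q F gF f gf xstar,
        vnorm xstar <= 1 &
        (expect_traj N pi Q
           (fun zs => vnorm2 (output d (run_oracle (query d) gF zs [::]) - xstar))
           <= eps ->
         tau%:R * Num.sqrt (L / mu) * ln (1 / eps) / 24 <= N%:R)].
Proof.
move=> mu0 muL tau0 eps0 leps.
have L0 : 0 < L by lra.
pose s := Num.sqrt (L / mu).
have s2 : s ^+ 2 = L / mu by rewrite sqr_sqrtr // divr_ge0 // ltW.
have s0 : 0 <= s by exact: sqrtr_ge0.
have s4 : 4 <= s.
  have : 4 ^+ 2 <= s ^+ 2 by rewrite s2 ler_pdivlMr // -natrX.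
  by rewrite ler_pXn2r ?nnegrE.
(* With [c = L / 4] this gives both [4 c = L] for smoothness and [c (1 - q)^2 = mu] for
   convexity. *)
pose dl := 2 / s.
have dl0 : 0 < dl by rewrite divr_gt0 //; lra.
have dlh : dl <= 1 / 2 by rewrite ler_pdivrMr; lra.
pose q := 1 - dl.
have qh : 1 / 2 <= q < 1 by rewrite /q; apply/andP; split; lra.
have q01 : 0 < q < 1 by have [? ?] := andP qh; apply/andP; split; lra.
have [q0 q1] := andP q01.
pose c := L / 4.
have c0 : 0 < c by rewrite divr_gt0.
have cmu : c * (1 - q) ^+ 2 = mu.
  rewrite /q opprB addrC subrK /dl expr_div_n s2 /c; field.
  by rewrite !gt_eqF.
(* The chain is long enough for the truncated tail of [geo] to weigh at most [eps]. *)
have [n nP] := exists_expn_le q eps q01 eps0.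
have tailP : q ^+ (2 * n.+1) <= eps.
  apply: le_trans nP; rewrite ler_wiXn2l ?(ltW q0) ?(ltW q1) //.
  by rewrite mul2n -addnn addSn ltnW // ltnS leq_addr.
have b0 : 0 < c * q by rewrite mulr_gt0.
have den0 : 0 < mu + c * q * (6 * n%:R + 15).
  by rewrite addr_gt0 ?mulr_gt0 // ltr_wpDl ?mulr_ge0.
(* The largest radius that [r_small] allows. *)
pose r := mu * (Num.sqrt (1 - q ^+ 2) * q ^+ n) / (mu + c * q * (6 * n%:R + 15)).
have r0 : 0 < r.
  by rewrite divr_gt0 ?mulr_gt0 ?exprn_gt0 // sqrtr_gt0 (sub1_sqr_gt0 _ q01).
have r_small : r * (c * (1 - q) ^+ 2 + c * q * (6 * n%:R + 15)) <=
    c * (1 - q) ^+ 2 * (Num.sqrt (1 - q ^+ 2) * q ^+ n).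
  by rewrite cmu /r divfK // gt_eqF.
pose G (y : 'rV[R]_n.+1) (z : bool) := chain_g c q y + (-1) ^+ z *: mask_g c q r y.
pose d := (2 * (\sum_(k < N.+1) 2 ^ k) + n.+1).+1.
have [V VV Vup] := @resisting_basis R d n mu G N (query d) (output d)
  (fun l y z l0 yl => chain_progress c q r l y z l0 yl) (ltnSn _).
pose p : bool -> R := fun=> 1 / 2.
pose F z (y : 'rV[R]_n.+1) := chain_f c q y + (-1) ^+ (z : bool) * mask_f c q r y.
have th01 := @refresh_01 R tau tau0.
have sc : strongly_convex mu (lift_f mu V (chain_f c q)) (lift_g mu V (chain_g c q)).
  by apply: lift_convex => //; rewrite -{1}cmu; apply: chain_convex.
have g0 : lift_g mu V (chain_g c q) (geo q *m V^T) = 0.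
  by rewrite /lift_g embK // chain_g_geo // mul0mx subrr scaler0 addr0.
exists d, bool, p, (resample (refresh tau) p), (fun x z => lift_f mu V (F z) x),
  (fun x z => lift_g mu V (G^~ z) x), (lift_f mu V (chain_f c q)),
  (lift_g mu V (chain_g c q)), (geo q *m V^T).
split; last 2 first.
- by rewrite /vnorm vnorm2_emb // vnorm_geo.
- move=> le_eps.
  have th0 := @refresh_gt0 R tau tau0; have th1 := @refresh_le R tau tau0.
  have dp : is_distr p by exact: half_distr.
  set th : R := refresh tau in th0 th1 th01 le_eps.
  (* On each trajectory the projected output is supported below the final level, so its error is at
     least the tail of [geo] from there. *)
  have h1 : \sum_(t : N.-tuple bool) traj_prob p (resample th p) t *
      ((q ^+ 2) ^+ foldl advance 1%N t - q ^+ (2 * n.+1)) <= eps.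
    apply: le_trans le_eps; apply: ler_sum => t _; apply: ler_wpM2l.
      apply: traj_prob_ge0 => [z|z w]; first by rewrite /p divr_ge0.
      by have [] := resample_kernel th01 dp z.
    have up := Vup t; rewrite size_tuple leqnn in up.
    rewrite -exprM; apply: le_trans (geo_tail_dist _ q01 _ _ (up isT)) _.
    rewrite -[X in vnorm2 (_ - X)](embK _ VV) -mulmxBl.
    exact: vnorm2_proj_le.
  have a01 : 0 <= q ^+ 2 <= 1 by rewrite exprn_ge0 ?exprn_ile1 ?(ltW q0) ?(ltW q1).
  have h2 := level_expectation th (q ^+ 2) N th01 a01.
  have h3 : (q ^+ 2) ^+ 2 * (1 - th / 2 + th / 2 * q ^+ 2) ^+ N <= 2 * eps.
    apply: le_trans h2 _; move: h1; under eq_bigr do rewrite mulrBr.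
    rewrite sumrB -mulr_suml (sum_traj_prob1 _ _ N dp (resample_kernel th01 dp)).
    by rewrite /p; lra.
  have h6 := geometric_rate th dl eps N th0 th1 dl0 dlh eps0 leps h3.
  have ht : 1 <= tau%:R :> R by rewrite ler1n.
  have h7 : N%:R * (2 * (th * dl)) <= N%:R * (2 * (3 / tau%:R * dl)).
    rewrite ler_wpM2l // ler_pM2l // ler_wpM2r ?(ltW dl0) //.
    exact: refresh_le_inv.
  have h8 : ln (1 / eps) / 2 <= N%:R * (2 * (3 / tau%:R * dl)) by lra.
  have tR0 : 0 < tau%:R :> R by rewrite ltr0n.
  have k0 : 0 < 2 * (3 / tau%:R * dl) by apply: mulr_gt0 => //; apply: mulr_gt0 dl0; exact: divr_gt0.
  rewrite -(@ler_pM2r _ (2 * (3 / tau%:R * dl))) //; apply: le_trans h8.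
  rewrite -/s /dl le_eqVlt; apply/orP; left; apply/eqP; field.
  by rewrite !gt_eqF // (lt_le_trans _ s4).
have gFE x z : lift_g mu V (G^~ z) x =
    lift_g mu V (chain_g c q) x + (-1) ^+ z *: (mask_g c q r (x *m V) *m V^T).
  by rewrite /lift_g /G mulmxDl (addrAC (_ *m _)) -(scalemxAl ((-1) ^+ z)).
rewrite /valid_instance; repeat match goal with |- _ /\ _ => split end => //.
- exact: resample_kernel half_distr.
- exact: resample_unique (refresh_gt0 _ tau0) half_distr.
- exact: resample_mixing half_distr (refresh_pow _ tau0).
- move=> z; apply: qgrad_is_gradient => x; apply: lift_qgrad => //; first exact: ltW.
  apply: qgradD; first exact: chain_qgrad.
  by apply: qgradZ; exact: mask_qgrad.
- by move=> x; rewrite big_bool /lift_f /F /p /= expr0 expr1; field.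
- apply: qgrad_is_gradient => x; apply: lift_qgrad => //; first exact: ltW.
  exact: chain_qgrad.
- apply: lift_smooth => //; [exact: ltW|lra|].
  by apply: chain_smooth => //; rewrite /c; lra.
- move=> x; rewrite big_bool !gFE /p /= expr0 expr1 scale1r scaleN1r -scalerDr.
  by rewrite addrACA addNr addr0 -mulr2n -(scaler_nat 2 (lift_g _ _ _ _)) scalerA mul1r mulVf ?scale1r.
- move=> x z; rewrite expr1n mul1r; apply: ler_wpDl; first exact: sqr_ge0.
  rewrite gFE addrAC subrr add0r scalemxAl.
  rewrite vnorm2_emb // vnorm2Z sqrr_sign mul1r.
  rewrite /lift_g vnorm2_lift //; apply: ler_wpDr.
    by rewrite mulr_ge0 ?sqr_ge0 // subr_ge0 vnorm2_proj_le.
  by rewrite -!vnorm_sqr ler_pXn2r ?nnegrE ?vnorm_ge0 // mask_le.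
- exact: strongly_convex_minimizer (ltW mu0) sc g0.
Qed.

End ChainInstance.

(** * Choice among the three instances *)

Theorem theorem2 (R : realType) :
  exists c eps0 : R, 0 < c /\ 0 < eps0 /\
  forall (sigma L mu : R) (tau : nat) (eps : R) (N : nat)
         (query output : forall d : nat, seq 'rV[R]_d -> 'rV[R]_d),
    0 <= sigma -> 0 < mu -> mu < L -> (0 < tau)%N -> 0 < eps -> eps < eps0 ->
    exists (d : nat) (S : finType) (pi : S -> R) (Q : S -> S -> R)
           (F : 'rV[R]_d -> S -> R) (gF : 'rV[R]_d -> S -> 'rV[R]_d)
           (f : 'rV[R]_d -> R) (gf : 'rV[R]_d -> 'rV[R]_d) (xstar : 'rV[R]_d),
      [/\ valid_instance sigma L mu tau pi Q F gF f gf xstar,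
          vnorm xstar <= 1 &
          (expect_traj N pi Q
             (fun zs => vnorm2 (output d (run_oracle (query d) gF zs [::]) - xstar))
             <= eps ->
           c * (tau%:R * Num.sqrt (L / mu) * ln (1 / eps)
                + tau%:R * sigma ^+ 2 / (mu ^+ 2 * eps)) <= N%:R)].
Proof.
(* Half of [1 / 384], the smallest of the three constants, because the sum is at most twice the
   larger term. The threshold makes [ln (1 / eps)] at least 1024. *)
exists (1 / 768), (expR (- 1024)); split; first by lra.
split=> [|sigma L mu tau eps N query output sigma0 mu0 muL tau0 eps0 epslt].
  exact: expR_gt0.
have leps : 1024 <= ln (1 / eps).
  have -> : ln (1 / eps) = - ln eps by rewrite mul1r lnV ?posrE.
  by rewrite lerNr -(@expRK R (- 1024)) ler_ln ?posrE ?expR_gt0 // ltW.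
have tau1 : 1 <= tau%:R :> R by rewrite ler1n.
have l0 : 0 <= ln (1 / eps) by lra.
set s : R := Num.sqrt (L / mu); set l : R := ln (1 / eps) in leps l0 *.
have s1 : 1 <= s by rewrite -sqrtr1 ler_wsqrtr // ler_pdivlMr // mul1r ltW.
have [T21|T12] := leP (tau%:R * sigma ^+ 2 / (mu ^+ 2 * eps)) (tau%:R * s * l).
  have T0 : 0 <= tau%:R * s * l by rewrite !mulr_ge0 //; lra.
  have [kL|kL] := leP (16 * mu) L.
    have [|d [S [p [Q [F [gF [f [gf [xs [H1 H2 H3]]]]]]]]]] :=
      @chain_instance R sigma L mu tau eps N query output mu0 kL tau0 eps0; first by rewrite -/l; lra.
    exists d, S, p, Q, F, gF, f, gf, xs; split=> // /H3; rewrite -/s -/l.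
    by move: T21 T0; lra.
  have [|d [S [p [Q [F [gF [f [gf [xs [H1 H2 H3]]]]]]]]]] :=
    @silent_instance R sigma L mu tau eps N query output mu0 muL tau0 eps0; first by rewrite -/l; lra.
  exists d, S, p, Q, F, gF, f, gf, xs; split=> // /H3; rewrite -/l.
  have s4 : s <= 4.
    rewrite (_ : 4 = Num.sqrt (4 ^+ 2)); last by rewrite sqrtr_sqr ger0_norm.
    by rewrite ler_wsqrtr // ler_pdivrMr // -natrX ltW.
  have : tau%:R * s * l <= 4 * (tau%:R * l).
    rewrite mulrAC [leRHS]mulrC ler_wpM2l // mulr_ge0 //; lra.
  by move: T21; lra.
have q0 : 0 < mu ^+ 2 * eps by rewrite mulr_gt0 ?exprn_gt0.
(* When the noise term dominates, [sigma ^+ 2 / (mu ^+ 2 * eps)] exceeds [s * l], which is at least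
   1024. *)
have big : 1024 * (mu ^+ 2 * eps) <= sigma ^+ 2.
  rewrite -ler_pdivlMr // -(@ler_pM2l _ tau%:R); last by lra.
  rewrite mulrA; apply: le_trans (ltW T12); rewrite -mulrA ler_wpM2l //.
  by apply: le_trans leps _; rewrite ler_peMl.
have sigma_gt0 : 0 < sigma.
  rewrite lt_neqAle sigma0 andbT; apply: contraTneq q0 => s00.
  by move: big; rewrite -s00 expr0n /= -leNgt; lra.
have eps8 : 8 * eps <= 1.
  rewrite -ler_pdivlMr //; have := expR_ge1Dx l; rewrite /l lnK ?posrE ?divr_gt0 //.
  by rewrite -/l; lra.
have [d [S [p [Q [F [gF [f [gf [xs [H1 H2 H3]]]]]]]]]] :=
  @statistical_instance R sigma L mu tau eps N query output sigma_gt0 mu0 muL tau0 eps0 eps8 big.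
exists d, S, p, Q, F, gF, f, gf, xs; split=> // /H3.
by move: T12; lra.
Qed.
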